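(* Let $N_t, N_m, N_e$ be positive integers with $N_e < N_t$, put $n = N_t - N_e$, $m = \min(n, N_m)$ and $k = \max(n, N_m)$. Let $\mathbf{H}$ be an $N_m \times n$ random matrix with i.i.d. circularly symmetric complex Gaussian entries of zero mean and unit variance. Let $\eta > 0$, $g > 0$, $r_s > 0$, and set $R_s = r_s \ln(1+g\eta)$. Define $$P_{out}^{ZF} = \Pr\Big[\ln\det\Big(I_{N_m} + \tfrac{\eta}{n}\mathbf{H}\mathbf{H}^{\dagger}\Big) < R_s\Big].$$ Then for all positive coefficients $b_1,\dots,b_m$ satisfying $b_m \le b_{m-1} \le \dots \le b_1$ and $\sum_{l=1}^m b_l = r_s$, $$P_{out}^{ZF} \le \prod_{l=1}^{m}\Gamma_{inc}(\xi(r_s),k-l+1)\left(1-\prod_{l=1}^{m}\Big[1-\frac{\Gamma_{inc}(\xi(b_l),k-l+1)}{\Gamma_{inc}(\xi(r_s),k-l+1)}\Big]\right),$$ where $\xi(x) = \frac{n}{\eta}\big((1+g\eta)^x - 1\big)$.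
   Context: $\Gamma_{inc}$ denotes the regularized lower incomplete Gamma function: for $x \ge 0$ and a positive integer $a$, $\Gamma_{inc}(x,a) = \frac{1}{(a-1)!}\int_0^x t^{a-1}e^{-t}\,dt$. $\mathbf{H}^\dagger$ is the conjugate transpose. $P_{out}^{ZF}$ is the outage probability of the zero-forcing transmit scheme for the MIMO wiretap channel ($N_t$ transmit, $N_m$ legitimate-receiver, $N_e$ eavesdropper antennas), with SNR $\eta$, array gain $g$, and secrecy multiplexing gain $r_s$. *)

(* Defs.v *)
From mathcomp Require Import all_boot all_order all_algebra.
From mathcomp Require Import all_classical all_reals all_analysis.
Set Implicit Arguments. Unset Strict Implicit. Unset Printing Implicit Defensive.
Import Order.TTheory GRing.Theory Num.Theory.
From mathcomp Require Import complex.
Local Open Scope classical_set_scope.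
Local Open Scope ring_scope.

(* Regularized lower incomplete Gamma function for a positive integer a:
   Gamma_inc x a = 1/(a-1)! * int_0^x t^(a-1) e^(-t) dt. *)
Definition Gamma_inc {R : realType} (x : R) (a : nat) : R :=
  ((a.-1)`!%:R)^-1 *
  Rintegral (@lebesgue_measure R) `[0, x] (fun t => t ^+ a.-1 * expR (- t)).

(* xi(x) = n/eta * ((1 + g eta)^x - 1) *)
Definition xi {R : realType} (n : nat) (eta g x : R) : R :=
  n%:R / eta * ((1 + g * eta) `^ x - 1).

(* Conjugate transpose of a complex matrix. *)
Definition ctrmx {R : rcfType} (p q : nat) (A : 'M[R[i]]_(p, q)) : 'M[R[i]]_(q, p) :=
  (map_mx (fun z : R[i] => z^*) A)^T.

(* H : T -> 'M[R[i]]_(p,q) is a random matrix on (T, P) whose entries are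
   i.i.d. circularly symmetric complex Gaussian CN(0,1): the 2pq real random
   variables Re H_ij, Im H_ij are measurable and jointly distributed as
   independent N(0, 1/2) variables (product rule on all measurable boxes,
   which determines the joint law). *)
Definition iid_CN01 {R : realType} {d : measure_display} {T : measurableType d}
  (P : probability T R) (p q : nat) (H : T -> 'M[R[i]]_(p, q)) : Prop :=
  (forall (i : 'I_p) (j : 'I_q),
      measurable_fun setT (fun t => complex.Re (H t i j)) /\
      measurable_fun setT (fun t => complex.Im (H t i j))) /\
  (forall A B : 'I_p -> 'I_q -> set R,
      (forall i j, measurable (A i j) /\ measurable (B i j)) ->
      P [set t | forall i j, A i j (complex.Re (H t i j)) /\ B i j (complex.Im (H t i j))]
      = (\prod_(i < p) \prod_(j < q)
           (fine (normal_prob 0 (Num.sqrt (2^-1)) (A i j)) *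
            fine (normal_prob 0 (Num.sqrt (2^-1)) (B i j))))%:E).

(* Outage probability of the ZF scheme:
   Pr[ ln det(I + eta/n H H^dagger) < R_s ],  R_s = r_s ln(1 + g eta).
   The determinant of the Hermitian positive definite matrix is real; we take
   its real part. *)
Definition outage_ZF {R : realType} {d : measure_display} {T : measurableType d}
  (P : probability T R) (Nm n : nat) (H : T -> 'M[R[i]]_(Nm, n)) (eta g rs : R)
  : \bar R :=
  P [set t | ln (complex.Re (\det (1%:M + ((eta / n%:R)%:C)%C *: (H t *m ctrmx (H t)))))
             < rs * ln (1 + g * eta)].

(* Main.v *)
Require Import Defs.
From mathcomp Require Import all_boot all_order all_algebra.
From mathcomp Require Import all_classical all_reals all_analysis.
Import Order.TTheory GRing.Theory Num.Theory.
From mathcomp Require Import complex.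
From mathcomp Require Import measurable_realfun ring.
Import numFieldNormedType.Exports.
Set Implicit Arguments. Unset Strict Implicit. Unset Printing Implicit Defensive.
Local Open Scope classical_set_scope.
Local Open Scope ring_scope.

(** Up to transposition (Sylvester's identity) [H] is a [p x q] matrix with
    [p = m <= q = k]. Fix its first row [a]. A unitary map of [C^q], depending
    only on [a], sends [a] to [(|a|, 0, ..., 0)] and leaves the law of the other
    rows unchanged; a Schur complement then gives
    [det (I + c H H^h) >= (1 + c |a|^2) det (I + c H' H'^h)], where [^h] is the
    conjugate transpose and [H'] the remaining [(p-1) x (q-1)] block, again
    i.i.d. and independent of [a].
    Hence the determinant dominates, in law, [prod_l (1 + c X_l)] with
    independent [X_l] of law [Gamma(q - l + 1)]. If that product is below
    [(1 + g eta)^rs = prod_l (1 + g eta)^(b_l)], then every [X_l] is below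
    [xi(rs)] and some [X_l] is below [xi(b_l)]; the right-hand side is the
    probability of this last event. *)

(** * Determinants of perturbed Gram matrices *)

(** The row [a] is frozen instead: the slice of the event over [a] is compared in probability with
    an event on the smaller block, and the bound is integrated over [a]. No joint law of the [X_l]
    is ever stated; an induction on the number of rows carries the probability bound itself. Write
    [F_l(y)] for the probability that [1 + c X_l < y], with [s = (1 + g eta)^rs] and
    [u_l = (1 + g eta)^(b_l)]. The last event is 'all factors below [s]' minus 'every factor in
    [[u_l, s)]', whence [prod F_l(s) - prod (F_l(s) - F_l(u_l))]. The induction uses this form,
    which has no quotients. Invariance of the Gaussian law is proved for rotations of a real plane
    only; the unitary map is composed of such rotations. *)

Lemma det_1D_mulmxC (K : comPzRingType) (m n : nat)
    (A : 'M[K]_(m, n)) (B : 'M[K]_(n, m)) :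
  \det (1%:M + A *m B) = \det (1%:M + B *m A).
Proof.
(* The determinant of [M] is read off two block triangular factorisations, one for each side. *)
pose M := block_mx (1%:M : 'M[K]_m) (- A) B (1%:M : 'M[K]_n).
have h1 : M = block_mx 1%:M 0 B 1%:M *m block_mx 1%:M (- A) 0 (1%:M + B *m A).
  rewrite mulmx_block !mul1mx !mulmx1 !mul0mx !addr0.
  by rewrite mulmxN addrCA addNr addr0.
have h2 : M = block_mx 1%:M (- A) 0 1%:M *m block_mx (1%:M + A *m B) 0 B 1%:M.
  rewrite mulmx_block !mul1mx !mulmx1 !mul0mx !add0r.
  by rewrite mulNmx addrK.
have := congr1 (@determinant _ _) h1.
by rewrite h2 !det_mulmx !det_ublock !det_lblock !det1 !mul1r !mulr1.
Qed.

Section gram.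
Variable R : rcfType.
Local Notation C := R[i].

Lemma ctrmxE (p q : nat) (A : 'M[C]_(p, q)) i j : ctrmx A i j = (A j i)^*.
Proof. by rewrite !mxE. Qed.

Lemma ctrmxK (p q : nat) (A : 'M[C]_(p, q)) : ctrmx (ctrmx A) = A.
Proof. by apply/matrixP => i j; rewrite !mxE conjCK. Qed.

Lemma ctrmxM (p q r : nat) (A : 'M[C]_(p, q)) (B : 'M[C]_(q, r)) :
  ctrmx (A *m B) = ctrmx B *m ctrmx A.
Proof.
apply/matrixP => i j; rewrite !mxE rmorph_sum; apply: eq_bigr => k _.
by rewrite !mxE rmorphM mulrC.
Qed.

Lemma ctrmxD (p q : nat) (A B : 'M[C]_(p, q)) : ctrmx (A + B) = ctrmx A + ctrmx B.
Proof. by apply/matrixP => i j; rewrite !mxE rmorphD. Qed.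

Lemma ctrmxZ (p q : nat) a (A : 'M[C]_(p, q)) : ctrmx (a *: A) = a^* *: ctrmx A.
Proof. by apply/matrixP => i j; rewrite !mxE rmorphM. Qed.

Lemma ctrmx1 p : ctrmx (1%:M : 'M[C]_p) = 1%:M.
Proof. by apply/matrixP => i j; rewrite !mxE eq_sym rmorph_nat. Qed.

Lemma ctrmx0 p q : ctrmx (0 : 'M[C]_(p, q)) = 0.
Proof. by apply/matrixP => i j; rewrite !mxE rmorph0. Qed.

Lemma ctrmx_scalar p (a : C) : ctrmx (a%:M : 'M[C]_p) = (a^*)%:M.
Proof. by apply/matrixP => i j; rewrite !mxE eq_sym rmorphMn. Qed.

Lemma ctrmx_row (p q r : nat) (A : 'M[C]_(p, q)) (B : 'M[C]_(p, r)) :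
  ctrmx (row_mx A B) = col_mx (ctrmx A) (ctrmx B).
Proof. by rewrite /ctrmx map_row_mx tr_row_mx. Qed.

Lemma ctrmx_col (p q r : nat) (A : 'M[C]_(p, q)) (B : 'M[C]_(r, q)) :
  ctrmx (col_mx A B) = row_mx (ctrmx A) (ctrmx B).
Proof. by rewrite /ctrmx map_col_mx tr_col_mx. Qed.

Lemma form_gram_ge0 (p q : nat) (B : 'M[C]_(p, q)) i :
  0 <= (B *m ctrmx B) i i.
Proof. by rewrite !mxE sumr_ge0 // => k _; rewrite !mxE mul_conjC_ge0. Qed.

(** Kept complex: in the partial order of [R[i]], [1 <= detI c B] also says that the determinant is
    real. *)
Definition detI p q (c : C) (B : 'M[C]_(p, q)) : C :=
  \det (1%:M + c *: (B *m ctrmx B)).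

Section posdef.
Variables (p q : nat) (c : C) (B : 'M[C]_(p, q)).
Hypothesis c0 : 0 <= c.
Let A := 1%:M + c *: (B *m ctrmx B).

Let form_ge (x : 'rV[C]_p) : (x *m ctrmx x) 0 0 <= (x *m A *m ctrmx x) 0 0.
Proof.
rewrite /A mulmxDr mulmx1 mulmxDl [X in _ <= X]mxE lerDl -scalemxAr -scalemxAl [X in _ <= X]mxE.
have -> : x *m (B *m ctrmx B) *m ctrmx x = (x *m B) *m ctrmx (x *m B) by rewrite ctrmxM !mulmxA.
by rewrite mulr_ge0 //; exact: form_gram_ge0.
Qed.

(** A row [x] of the kernel satisfies [x x^h <= x A x^h = 0], so it vanishes. *)
Lemma unitmx_1Dgram : A \in unitmx.
Proof.
rewrite -row_free_unit -kermx_eq0; apply/eqP/row_matrixP => i.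
rewrite row0; set x := row i _.
have xA : x *m A = 0 by rewrite /x -row_mul mulmx_ker row0.
have := form_ge x; rewrite xA mul0mx [X in _ <= X]mxE.
move=> h; have : (x *m ctrmx x) 0 0 = 0.
  by apply/eqP; rewrite eq_le h form_gram_ge0.
rewrite mxE => /eqP; rewrite psumr_eq0; last first.
  by move=> k _; rewrite !mxE mul_conjC_ge0.
move=> /allP xk; apply/matrixP => a k; rewrite ord1 [RHS]mxE.
have := xk k (mem_index_enum _); rewrite !mxE implyTb mul_conjC_eq0.
by move/eqP.
Qed.

Lemma ctrmx_1Dgram : ctrmx A = A.
Proof.
by rewrite /A ctrmxD ctrmx1 ctrmxZ ctrmxM ctrmxK (conj_Creal (ger0_real c0)).
Qed.

(** The ratio of the two determinants is [1 + e v^h A^-1 v]. With [y = A^-1 v] the form is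
    [y^h A y], at least [y^h y >= 0]. Nonnegativity of [\det A] is assumed because [detI_ge1]
    obtains it by an induction through this very lemma. *)
Lemma det_1Dgram_rank1 (e : C) (v : 'cV[C]_p) : 0 <= e -> 0 <= \det A ->
  \det A <= \det (A + e *: (v *m ctrmx v)).
Proof.
move=> e0 dA.
have -> : A + e *: (v *m ctrmx v) =
    A *m (1%:M + (e *: invmx A *m v) *m ctrmx v).
  rewrite mulmxDr mulmx1 -!scalemxAl -scalemxAr !mulmxA.
  by rewrite mulmxV ?unitmx_1Dgram // mul1mx.
rewrite det_mulmx det_1D_mulmxC [X in _ * X]det_mx11.
rewrite ler_peMr // !mxE /= lerDl.
set y := invmx A *m v.
have Ay : A *m y = v by rewrite mulmxA mulmxV ?unitmx_1Dgram // mul1mx.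
have vy : ctrmx v *m y = ctrmx y *m A *m ctrmx (ctrmx y).
  by rewrite ctrmxK -{1}Ay ctrmxM ctrmx_1Dgram.
have := form_ge (ctrmx y); rewrite -vy => h.
have h0 : 0 <= (ctrmx v *m y) 0 0 by apply: le_trans h; exact: form_gram_ge0.
have -> : \sum_j ctrmx v 0 j * (e *: invmx A *m v) j 0 = e * (ctrmx v *m y) 0 0.
  rewrite -scalemxAl -/y [in RHS]mxE mulr_sumr; apply: eq_bigr => j _.
  by rewrite [(e *: y) j 0]mxE mulrCA.
exact: mulr_ge0.
Qed.

End posdef.

(** A further column [b] adds the rank-one term [c b b^h], so the determinant grows from 1, its
    value without columns. *)
Lemma detI_ge1 p q (c : C) (B : 'M[C]_(p, q)) : 0 <= c -> 1 <= detI c B.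
Proof.
move=> c0; rewrite /detI; elim: q B => [|q IH] B.
  by rewrite [B]thinmx0 mul0mx scaler0 addr0 det1.
rewrite -[B](@hsubmxK _ p 1 q); move: (lsubmx _) (rsubmx _) => b B'.
rewrite (@ctrmx_row p 1 q b B') (@mul_row_col _ p 1 q p).
rewrite scalerDr [c *: (b *m _) + _]addrC addrA.
by apply: (le_trans (IH B')); apply: det_1Dgram_rank1 => //; exact: le_trans (IH B').
Qed.

(** Eliminating the corner [a = 1 + c rho^2] leaves [1 + c W W^h + (c / a) w w^h], since
    [c - c^2 rho^2 / a = c / a]. Dropping the rank-one term is the only loss made on
    determinants. *)
Lemma detI_block_ge p q (c rho : C) (w : 'cV[C]_p) (W : 'M[C]_(p, q)) :
  0 <= c -> 0 <= rho ->
  (1 + c * rho ^+ 2) * detI c W <=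
  detI c (block_mx (rho%:M : 'M[C]_1) (0 : 'rV[C]_q) w W).
Proof.
move=> c0 r0; rewrite /detI.
set a := 1 + c * rho ^+ 2.
have a1 : 1 <= a by rewrite lerDl mulr_ge0 // exprn_ge0.
have a0 : a != 0 by rewrite gt_eqF // (lt_le_trans _ a1).
have rr : rho^* = rho by rewrite (conj_Creal (ger0_real r0)).
have -> : ctrmx (block_mx (rho%:M : 'M[C]_1) (0 : 'rV[C]_q) w W) =
    block_mx (rho%:M) (ctrmx w) 0 (ctrmx W).
  by rewrite [RHS]block_mxEh /block_mx ctrmx_col !ctrmx_row ctrmx_scalar ctrmx0 rr.
rewrite mulmx_block !mul0mx !mulmx0 !addr0 -scalar_mxM.
have -> : 1%:M + c *: block_mx (rho * rho)%:M (rho%:M *m ctrmx w)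
      (w *m rho%:M) (w *m ctrmx w + W *m ctrmx W) =
    block_mx (1%:M : 'M[C]_1) 0 ((c * rho / a) *: w) 1%:M *m
    block_mx (a%:M : 'M[C]_1) ((c * rho) *: ctrmx w) 0
      (1%:M + c *: (W *m ctrmx W) + (c / a) *: (w *m ctrmx w)).
  rewrite scale_block_mx (_ : 1%:M = block_mx 1%:M 0 0 1%:M) ?scalar_mx_block//.
  rewrite add_block_mx mulmx_block !mul1mx !mul0mx ?mulmx0 ?add0r ?addr0.
  rewrite mul_scalar_mx mul_mx_scalar !scalerA mul_mx_scalar !scalerA.
  congr block_mx.
  - by apply/matrixP => i j; rewrite !ord1 !mxE !eqxx /a; ring.
  - by congr (_ *: _); field.
  - rewrite -scalemxAl -scalemxAr scalerA [in RHS]addrC -!addrA; congr (_ + _).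
    rewrite scalerDr addrC; congr (_ + _); rewrite -scalerDl; congr (_ *: _).
    by rewrite /a in a0 *; field.
rewrite det_mulmx det_lblock det_ublock !det1 !mul1r det_scalar1.
rewrite ler_wpM2l // ?(le_trans ler01 a1) //.
apply: det_1Dgram_rank1 => //; first by rewrite divr_ge0 // (le_trans ler01 a1).
exact: le_trans (detI_ge1 W c0).
Qed.

(** Sylvester's identity passes to [B^h B], whose transpose is the Gram matrix of [B^T]. *)
Lemma detI_tr p q (c : C) (B : 'M[C]_(p, q)) : detI c B = detI c B^T.
Proof.
rewrite /detI scalemxAl det_1D_mulmxC -scalemxAr -det_tr linearD linearZ /=.
rewrite tr_scalar_mx trmx_mul; congr (\det (_ + _ *: (_ *m _))).
by rewrite /ctrmx map_trmx.
Qed.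

End gram.

(** * Measure-preserving maps between probability spaces *)

Definition pushforward_measure d1 d2 (T1 : measurableType d1)
    (T2 : measurableType d2) (R : realType) (m : {measure set T1 -> \bar R})
    (f : T1 -> T2) (mf : measurable_fun setT f) : {measure set T2 -> \bar R} :=
  @measure_function_pushforward__canonical__measure_function_Measure
    _ _ _ _ _ m f mf.

(** Display, carrier and law are bundled so that [ppow] can be defined by recursion on its length:
    all three change at each step. *)
Record pspace (R : realType) := Pspace {
  pdisp : measure_display;
  psort :> measurableType pdisp;
  plaw : probability psort R }.

Section pspaces.
Variable R : realType.
Implicit Types X Y Z : pspace R.

Definition punit : pspace R := Pspace (\d_tt : probability unit R).

Definition pprod X Y : pspace R :=
  Pspace ((plaw X \x plaw Y)%E : probability (X * Y)%type R).

Fixpoint ppow X (n : nat) : pspace R :=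
  if n is n'.+1 then pprod X (ppow X n') else punit.

Definition mpres X Y (f : X -> Y) : Prop :=
  measurable_fun setT f /\
  forall A : set Y, measurable A -> plaw X (f @^-1` A) = plaw Y A.

(** Stated for finite measures rather than probabilities: the proof for products applies it to
    measures restricted to a strip, whose mass is not 1. *)
Definition determining X (G : set (set X)) : Prop :=
  (forall A, G A -> measurable A) /\
  forall m1 m2 : {measure set X -> \bar R}, (m1 setT < +oo)%E ->
    (m2 setT < +oo)%E -> (forall A, G A -> m1 A = m2 A) ->
  forall A, measurable A -> m1 A = m2 A.

Lemma determining_measurable X : determining (@measurable _ X).
Proof. by split => // m1 m2 _ _ + A mA; exact. Qed.

Lemma determining_sub X (G G' : set (set X)) :
  determining G -> G `<=` G' -> (forall A, G' A -> measurable A) ->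
  determining G'.
Proof.
move=> [_ hG] GG' mG'; split => // m1 m2 f1 f2 m12.
by apply: hG => // A /GG' /m12.
Qed.

Lemma measurable_pair X Y Z (f : X -> Y) (g : X -> Z) :
  measurable_fun setT f -> measurable_fun setT g ->
  measurable_fun setT (fun x => (f x, g x) : pprod Y Z).
Proof. exact: measurable_fun_pair. Qed.

Lemma mpres_determining X Y (f : X -> Y) (G : set (set Y)) :
  determining G -> measurable_fun setT f ->
  (forall A, G A -> plaw X (f @^-1` A) = plaw Y A) -> mpres f.
Proof.
move=> [_ hG] mf fG; split => // A mA.
apply: (hG (pushforward_measure (plaw X) mf) (plaw Y)) => //=.
- by rewrite /pushforward preimage_setT probability_setT ltry.
- by rewrite probability_setT ltry.
Qed.

(** With one side of a rectangle fixed, the measure of the rectangle is a finite measure of the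
    other side: restrict to a strip, then project. This extends the equality first to all [B], then
    to all [A]; measurable rectangles are stable under intersection and generate the product
    sigma-algebra. *)
Lemma determining_prod X Y (GX : set (set X)) (GY : set (set Y)) :
  determining GX -> determining GY ->
  @determining (pprod X Y)
    [set C | exists A B, [/\ GX A, GY B & C = A `*` B]].
Proof.
move=> [mGX hX] [mGY hY]; split.
  move=> _ [A [B [/mGX mA /mGY mB ->]]]; exact: measurableX.
move=> m1 m2 f1 f2 m12.
have fin1 C : measurable C -> (m1 C < +oo)%E.
  by move=> mC; apply: le_lt_trans f1; apply: le_measure => //; rewrite inE.
have fin2 C : measurable C -> (m2 C < +oo)%E.
  by move=> mC; apply: le_lt_trans f2; apply: le_measure => //; rewrite inE.
have step1 A B : GX A -> measurable B -> m1 (A `*` B) = m2 (A `*` B).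
  move=> GA mB; have mA := mGX _ GA.
  have mAT := measurableX mA (@measurableT _ Y).
  have E C : snd @^-1` C `&` (A `*` [set: Y]) = A `*` C.
    by apply/seteqP; split => -[x y] /=; tauto.
  have := hY (pushforward_measure (mrestr m1 mAT) (@measurable_snd _ _ X Y))
    (pushforward_measure (mrestr m2 mAT) (@measurable_snd _ _ X Y)).
  rewrite /= /pushforward /mrestr => h.
  rewrite -(E B); apply: h => //.
  - by rewrite E; exact: fin1.
  - by rewrite E; exact: fin2.
  - by move=> C GC; rewrite E; apply: m12; exists A, C.
have step2 A B : measurable A -> measurable B -> m1 (A `*` B) = m2 (A `*` B).
  move=> mA mB; have mTB := measurableX (@measurableT _ X) mB.
  have E C : fst @^-1` C `&` ([set: X] `*` B) = C `*` B.
    by apply/seteqP; split => -[x y] /=; tauto.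
  have := hX (pushforward_measure (mrestr m1 mTB) (@measurable_fst _ _ X Y))
    (pushforward_measure (mrestr m2 mTB) (@measurable_fst _ _ X Y)).
  rewrite /= /pushforward /mrestr => h.
  rewrite -(E A); apply: h => //.
  - by rewrite E; exact: fin1.
  - by rewrite E; exact: fin2.
  - by move=> C GC; rewrite E; exact: step1.
pose C : set (set (X * Y)) :=
  [set C | exists A, measurable A /\ exists B, measurable B /\ C = A `*` B].
move=> D mD; apply: (measure_unique C (fun=> setT)) => //.
- rewrite measurable_prod_measurableType //; congr (<<s _ >>).
  rewrite predeqE; split => [[A mA [B mB <-]]|[A [mA [B [mB ->]]]]].
    by exists A; split => //; exists B.
  by exists A => //; exists B.
- move=> /= _ _ [X1 [mX1 [X2 [mX2 ->]]]] [Y1 [mY1 [Y2 [mY2 ->]]]].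
  rewrite -setXI; exists (X1 `&` Y1); split; first exact: measurableI.
  by exists (X2 `&` Y2); split => //; exact: measurableI.
- by move=> n; exists setT; split => //; exists setT; rewrite setXTT.
- by rewrite bigcup_const.
- by move=> _ [A [mA [B [mB ->]]]]; exact: step2.
Qed.

Lemma plaw_prodE X Y (A : set X) (B : set Y) : measurable A -> measurable B ->
  plaw (pprod X Y) (A `*` B) = (plaw X A * plaw Y B)%E.
Proof. by move=> mA mB; exact: product_measure1E. Qed.

(** Only the first [n] terms of the sequence count; with infinite sequences the recursion is a mere
    shift. *)
Fixpoint boxset X (A : nat -> set X) (n : nat) : set (ppow X n) :=
  if n is n'.+1 then A 0%N `*` @boxset X (A \o S) n' else setT.

Arguments boxset {X} A n _ : rename.

Lemma measurable_boxset X (A : nat -> set X) n :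
  (forall i, measurable (A i)) -> measurable (boxset A n).
Proof.
elim: n A => [|n IH] A mA /=; first exact: measurableT.
by apply: measurableX => //; apply: IH => i; exact: mA.
Qed.

Lemma plaw_boxset X (A : nat -> set X) n : (forall i, measurable (A i)) ->
  plaw (ppow X n) (boxset A n) = (\prod_(i < n) fine (plaw X (A i)))%:E.
Proof.
elim: n A => [|n IH] A mA; first by rewrite big_ord0 /= diracT.
rewrite big_ord_recl EFinM -(IH (A \o S)); last by move=> i; exact: mA.
rewrite fineK ?fin_num_measure //.
apply: plaw_prodE => //; apply: measurable_boxset => i; exact: mA.
Qed.

Lemma determining_boxset X (G : set (set X)) n : determining G -> G setT ->
  @determining (ppow X n) [set boxset A n | A in [set A | forall i, G (A i)]].
Proof.
move=> dG GT; have mG := dG.1; elim: n => [|n IH].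
  split => [_ [A GA] <-|m1 m2 f1 f2 m12 A mA].
    by apply: measurable_boxset => i; exact/mG/GA.
  (* A subset of the one-point space is empty or full, and the full one is the box of the constant
     sequence [setT]. *)
  have [E|/set0P[[]] At] := eqVneq A set0; first by rewrite E !measure0.
  have -> : A = setT by apply/seteqP; split => // -[].
  by apply: m12; exists (fun=> setT).
apply: (determining_sub (determining_prod dG IH)).
  move=> _ [A [_ [GA [B GB <-] ->]]].
  by exists (fun i => if i is i'.+1 then B i' else A) => // -[|i] //=.
by move=> _ [A GA <-]; apply: (@measurable_boxset X A n.+1) => i; exact/mG/GA.
Qed.

Lemma mpres_comp X Y Z (f : X -> Y) (g : Y -> Z) :
  mpres f -> mpres g -> mpres (g \o f).
Proof.
move=> [mf hf] [mg hg]; split; first exact: measurableT_comp.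
move=> A mA; rewrite comp_preimage hf ?hg //.
by rewrite -[X in measurable X]setTI; exact: mg.
Qed.

Lemma mpres_id X : mpres (@id X).
Proof. by split. Qed.

Lemma mpres_prod X X' Y Y' (f : X -> X') (g : Y -> Y') : mpres f -> mpres g ->
  mpres ((fun z => (f z.1, g z.2)) : pprod X Y -> pprod X' Y').
Proof.
move=> [mf hf] [mg hg].
apply: (mpres_determining (determining_prod (determining_measurable X')
  (determining_measurable Y'))).
  by apply: measurable_pair; apply: measurableT_comp.
move=> _ [A [B [mA mB ->]]].
rewrite plaw_prodE // -hf // -hg // -plaw_prodE.
- by congr (plaw (pprod X Y) _); apply/seteqP; split => -[].
- by rewrite -[X in measurable X]setTI; exact: mf.
- by rewrite -[X in measurable X]setTI; exact: mg.
Qed.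

Lemma mpres_snd X Y : mpres (@snd X Y : pprod X Y -> Y).
Proof.
split=> [|A mA]; first exact: measurable_snd.
have -> : (@snd X Y) @^-1` A = setT `*` A by apply/seteqP; split => -[]//= ? ? [].
by rewrite plaw_prodE // probability_setT mul1e.
Qed.

Fixpoint ppow_map X Y (f : X -> Y) n : ppow X n -> ppow Y n :=
  if n is n'.+1 then fun z => (f z.1, @ppow_map X Y f n' z.2) else id.

Lemma mpres_ppow_map X Y (f : X -> Y) n : mpres f -> mpres (@ppow_map X Y f n).
Proof.
move=> hf; elim: n => [|n IH]; first exact: mpres_id.
exact: mpres_prod.
Qed.

Lemma mpres_swap_inner X Y Z W :
  mpres ((fun z => ((z.1.1, z.2.1), (z.1.2, z.2.2))) :
    pprod (pprod X Y) (pprod Z W) -> pprod (pprod X Z) (pprod Y W)).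
Proof.
have dm := @determining_measurable.
apply: (mpres_determining (determining_prod (determining_prod (dm X) (dm Z))
  (determining_prod (dm Y) (dm W)))).
  by do 2 (apply: measurable_pair); do 2 apply: measurableT_comp => //.
move=> _ [_ [_ [[A [B [mA mB ->]]] [C [D [mC mD ->]]] ->]]].
have -> : (fun z : pprod (pprod X Y) (pprod Z W) =>
     ((z.1.1, z.2.1), (z.1.2, z.2.2))) @^-1` ((A `*` B) `*` (C `*` D)) =
   (A `*` C) `*` (B `*` D).
  by apply/seteqP; split => -[[? ?] [? ?]] /=; tauto.
have mX := @measurableX.
rewrite !plaw_prodE //; try exact: mX.
by rewrite !muleA; congr (_ * _)%E; rewrite -!muleA; congr (_ * _)%E; rewrite muleC.
Qed.

End pspaces.

Arguments boxset {R X} A n _ : rename.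

(** * Gaussian measures on the plane *)

Section lebesgue_affine.
Variable R : realType.
Local Notation mR := (measurableTypeR R).
Local Notation mu := (@lebesgue_measure R).
Local Open Scope ereal_scope.

Lemma lebesgue_measure_translate (a : R) (A : set mR) : measurable A ->
  mu ((fun x : mR => (x + a)%R : mR) @^-1` A) = mu A.
Proof.
move=> mA; apply/esym.
have ma : measurable_fun setT (fun x : mR => (x + a)%R : mR).
  exact: measurable_funD.
pose m : {measure set mR -> \bar R} :=
  pushforward_measure mu ma.
apply: (@lebesgue_measure_unique R m) => //= _ [[l r] _ <-] /=.
rewrite /pushforward.
have -> : (fun x : mR => (x + a)%R : mR) @^-1` `]l, r] = `](l - a)%R, (r - a)%R]%classic.
  by apply/seteqP; split => x /=; rewrite !in_itv/= ltrBlDr lerBrDr.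
by rewrite !lebesgue_measure_itv /= !lte_fin ltrD2r -!EFinB opprB addrA subrK.
Qed.

Lemma lebesgue_measure_scale (a : R) (A : set mR) : a != 0%R -> measurable A ->
  `|a|%:E * mu ((fun x : mR => (a * x)%R : mR) @^-1` A) = mu A.
Proof.
move=> a0 mA; apply/esym.
have ma : measurable_fun setT (fun x : mR => (a * x)%R : mR).
  exact: measurable_funM.
pose m : {measure set mR -> \bar R} :=
  mscale (NngNum (normr_ge0 a)) (pushforward_measure mu ma).
suff h : forall X, ocitv X -> mu X = m X.
  by rewrite (lebesgue_measure_unique h mA).
move=> _ [[l r] _ <-]; rewrite /m /mscale /= /mscale /= /pushforward.
have [an|ap|az] := ltgtP a 0%R; last by rewrite az eqxx in a0.
(* A negative factor reverses the interval, so its closed end is now on the left; only the length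
   matters. *)
- have -> : (fun x : mR => (a * x)%R : mR) @^-1` `]l, r] = `[(r / a)%R, (l / a)%R[%classic.
    apply/seteqP; split => x /=; rewrite !in_itv/= ltr_ndivlMr// ler_ndivrMr//.
      by move=> /andP[h1 h2]; apply/andP; split; rewrite mulrC.
    by move=> /andP[h1 h2]; apply/andP; split; rewrite mulrC.
  rewrite !lebesgue_measure_itv /= !lte_fin ltr_ndivrMr// divfK//.
  case: ifP => _; last by rewrite mule0.
  by rewrite -!EFinB -EFinM ltr0_norm// mulrBr !mulNr !(mulrC a) !divfK// opprK addrC.
- have -> : (fun x : mR => (a * x)%R : mR) @^-1` `]l, r] = `](l / a)%R, (r / a)%R]%classic.
    apply/seteqP; split => x /=; rewrite !in_itv/= ltr_pdivrMr// ler_pdivlMr//.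
      by move=> /andP[h1 h2]; apply/andP; split; rewrite mulrC.
    by move=> /andP[h1 h2]; apply/andP; split; rewrite mulrC.
  rewrite !lebesgue_measure_itv /= !lte_fin ltr_pdivrMr// divfK//.
  case: ifP => _; last by rewrite mule0.
  by rewrite -!EFinB -EFinM gtr0_norm// mulrBr !(mulrC a) !divfK.
Qed.

Lemma ge0_integral_translate (a : R) (f : mR -> \bar R) :
  measurable_fun setT f -> (forall x, 0 <= f x) ->
  \int[mu]_x f (x + a)%R = \int[mu]_x f x.
Proof.
move=> mf f0.
have ma : measurable_fun setT (fun x : mR => (x + a)%R : mR).
  exact: measurable_funD.
have := @ge0_integral_pushforward _ _ _ _ R _ ma mu setT f measurableT mf (fun y _ => f0 y).
rewrite preimage_setT /= => <-.
by apply: eq_measure_integral => //= A mA _; exact: lebesgue_measure_translate.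
Qed.

Lemma ge0_integral_scale (a : R) (f : mR -> \bar R) : a != 0%R ->
  measurable_fun setT f -> (forall x, 0 <= f x) ->
  `|a|%:E * \int[mu]_x f (a * x)%R = \int[mu]_x f x.
Proof.
move=> a0 mf f0.
have ma : measurable_fun setT (fun x : mR => (a * x)%R : mR).
  exact: measurable_funM.
have := @ge0_integral_pushforward _ _ _ _ R _ ma mu setT f measurableT mf (fun y _ => f0 y).
rewrite preimage_setT /= => <-.
rewrite -(@ge0_integral_mscale _ _ R _ setT measurableT (NngNum (normr_ge0 a))) //.
by apply: eq_measure_integral => //= A mA _; exact: lebesgue_measure_scale.
Qed.

End lebesgue_affine.

(** * Rotation invariance of the planar Gaussian law *)

Section gauss_plane.
Variable R : realType.
Local Notation mR := (measurableTypeR R).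
Local Notation mu := (@lebesgue_measure R).
Local Notation sd := (Num.sqrt (2^-1 : R)).

Definition gaussR : pspace R := Pspace (normal_prob 0 sd : probability mR R).

Lemma sd_neq0 : sd != 0.
Proof. by rewrite gt_eqF // sqrtr_gt0 invr_gt0. Qed.

Lemma normal_pdf_sdE x : normal_pdf 0 sd x = (Num.sqrt pi)^-1 * expR (- x ^+ 2).
Proof.
rewrite normal_pdfE ?sd_neq0 // /normal_peak /normal_fun sqr_sqrtr ?invr_ge0 //.
rewrite -mulrnAl -mulr_natr mulVf // mul1r subr0 divr1 //.
Qed.

Lemma integral_gaussR (f : mR -> \bar R) : measurable_fun setT f ->
  (\int[plaw gaussR]_x `|f x| < +oo)%E ->
  (\int[plaw gaussR]_x f x = \int[mu]_x (f x * (normal_pdf 0 sd x)%:E))%E.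
Proof.
move=> mf finf.
have dom := @normal_prob_dominates R 0 sd.
have mpdf : measurable_fun setT (fun x : mR => (normal_pdf 0 sd x)%:E).
  by apply/measurable_EFinP; exact: measurable_normal_pdf.
rewrite -(Radon_Nikodym_change_of_variables dom)//=; last first.
  by apply/integrableP; split.
apply: ae_eq_integral => //.
- by apply: emeasurable_funM => //; exact: (measurable_int mu).
- exact: emeasurable_funM.
(* The Radon-Nikodym derivative equals the density almost everywhere, both having the same integral
   over every measurable set. *)
- apply: ae_eqe_mul2l => /=.
  rewrite Radon_NikodymE//=.
  case: cid => /= h [h1 h2 h3].
  apply: integral_ae_eq => //=.
  by move=> E E01 mE; rewrite -h3.
Qed.

Local Open Scope ereal_scope.

Definition gauss2_pdf (z : mR * mR) : R :=
  (pi^-1 * expR (- (z.1 ^+ 2 + z.2 ^+ 2)))%R.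

Lemma gauss2_pdfE x y :
  gauss2_pdf (x, y) = (normal_pdf 0 sd x * normal_pdf 0 sd y)%R.
Proof.
rewrite !normal_pdf_sdE /gauss2_pdf /= opprD expRD mulrACA -invfM -expr2.
by rewrite sqr_sqrtr ?pi_ge0.
Qed.

Lemma measurable_gauss2_pdf : measurable_fun setT gauss2_pdf.
Proof.
apply: measurable_funM => //; apply: measurableT_comp => //.
apply: measurableT_comp => //; apply: measurable_funD;
  apply: measurable_funX; [exact: measurable_fst|exact: measurable_snd].
Qed.

Lemma gauss2_pdf_ge0 z : (0 <= gauss2_pdf z)%R.
Proof. by rewrite mulr_ge0 ?expR_ge0 ?invr_ge0 ?pi_ge0. Qed.

(** Iterated Lebesgue integrals are the form on which shears act, one variable at a time. *)
Lemma gauss2E (A : set (mR * mR)) : measurable A ->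
  plaw (pprod gaussR gaussR) A =
  \int[mu]_x \int[mu]_y (\1_A (x, y) * gauss2_pdf (x, y))%:E.
Proof.
move=> mA /=; rewrite /product_measure1.
rewrite (integral_gaussR (f := normal_prob 0 sd \o xsection A)); last 2 first.
- exact: measurable_fun_xsection.
- apply: (@le_lt_trans _ _ (\int[plaw gaussR]_x (cst 1 x))).
    apply: ge0_le_integral => //=.
    + by apply: measurableT_comp => //; exact: measurable_fun_xsection.
    + move=> x _; rewrite gee0_abs ?measure_ge0 //; apply: probability_le1.
      exact: measurable_xsection.
  rewrite integral_cst// mul1e; exact: (le_lt_trans (probability_le1 _ measurableT) (ltry 1)).
apply: eq_integral => x _ /=.
have mx := measurable_xsection x mA.
rewrite /normal_prob integral_mkcond muleC -ge0_integralZl//=.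
- apply: eq_integral => y _; rewrite gauss2_pdfE patchE indicE.
  rewrite (_ : (y \in xsection A x) = ((x, y) \in A)); last first.
    by apply/idP/idP => /[!inE]; rewrite /xsection/= inE.
  by case: ifP => _; rewrite ?mul1r ?mul0r ?mule0 // EFinM.
- apply/(measurable_restrictT _ mx); apply: measurable_funTS.
  by apply/measurable_EFinP; exact: measurable_normal_pdf.
- by move=> y _; rewrite patchE; case: ifP => // _; rewrite lee_fin normal_pdf_ge0.
- by rewrite lee_fin normal_pdf_ge0.
Qed.

Definition shear1 (a : R) (z : mR * mR) : mR * mR := ((z.1 + a * z.2)%R, z.2).
Definition shear2 (a : R) (z : mR * mR) : mR * mR := (z.1, (z.2 + a * z.1)%R).
Definition plane_rot (c s : R) (z : mR * mR) : mR * mR :=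
  ((c * z.1 - s * z.2)%R, (s * z.1 + c * z.2)%R).

Lemma measurable_shear1 a : measurable_fun setT (shear1 a).
Proof.
apply: measurable_fun_pair; last exact: measurable_snd.
apply: measurable_funD; first exact: measurable_fst.
by apply: measurable_funM => //; exact: measurable_snd.
Qed.

Lemma measurable_shear2 a : measurable_fun setT (shear2 a).
Proof.
apply: measurable_fun_pair; first exact: measurable_fst.
apply: measurable_funD; first exact: measurable_snd.
by apply: measurable_funM => //; exact: measurable_fst.
Qed.

Lemma measurable_rot c s : measurable_fun setT (plane_rot c s).
Proof.
have mf : measurable_fun setT (@fst mR mR) by exact: measurable_fst.
have ms : measurable_fun setT (@snd mR mR) by exact: measurable_snd.
by apply: measurable_fun_pair; [apply: measurable_funB|apply: measurable_funD];
  apply: measurable_funM.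
Qed.

Section plane_integral.
Variable G : mR * mR -> \bar R.
Hypotheses (mG : measurable_fun setT G) (G0 : forall z, 0 <= G z).

(** For fixed [x] the shear translates the inner variable by [a * x]. *)
Lemma integral_shear2 a :
  \int[mu]_x \int[mu]_y G (shear2 a (x, y)) = \int[mu]_x \int[mu]_y G (x, y).
Proof.
apply: eq_integral => x _; rewrite /shear2 /=.
apply: (@ge0_integral_translate R (a * x) (fun y => G (x, y))) => //.
by apply: measurableT_comp => //; exact: pair1_measurable.
Qed.

Lemma integral_swap :
  \int[mu]_x \int[mu]_y G (x, y) = \int[mu]_y \int[mu]_x G (x, y).
Proof. exact: (@fubini_tonelli _ _ _ _ R mu mu G mG G0). Qed.

End plane_integral.

Lemma integral_shear1 a (G : mR * mR -> \bar R) :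
  measurable_fun setT G -> (forall z, 0 <= G z) ->
  \int[mu]_x \int[mu]_y G (shear1 a (x, y)) = \int[mu]_x \int[mu]_y G (x, y).
Proof.
move=> mG G0; rewrite integral_swap // (integral_swap (G := G \o shear1 a)) //.
- apply: eq_integral => y _; rewrite /shear1 /=.
  apply: (@ge0_integral_translate R (a * y) (fun x => G (x, y))) => //.
  by apply: measurableT_comp => //; exact: pair2_measurable.
- by apply: measurableT_comp => //; exact: measurable_shear1.
- by move=> z; exact: G0.
Qed.

(* A rotation of angle t is the product of the shears of slopes
   -tan(t/2), sin t and -tan(t/2); the angle pi is left out. *)
Lemma integral_rot_neqN1 (c s : R) (G : mR * mR -> \bar R) :
  (c ^+ 2 + s ^+ 2 = 1)%R -> c != (-1)%R ->
  measurable_fun setT G -> (forall z, 0 <= G z) ->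
  \int[mu]_x \int[mu]_y G (plane_rot c s (x, y)) = \int[mu]_x \int[mu]_y G (x, y).
Proof.
move=> cs c1 mG G0; pose t : R := (- (s / (1 + c)))%R.
have c1' : (1 + c != 0)%R by rewrite addrC addr_eq0.
have E z : plane_rot c s z = shear1 t (shear2 s (shear1 t z)).
  rewrite /plane_rot /shear1 /shear2 /=; case: z => x y /=.
  have ts : (t * s = c - 1)%R.
    have -> : (t * s = - (s ^+ 2) / (1 + c))%R by rewrite /t; ring.
    have -> : (s ^+ 2 = (1 - c) * (1 + c))%R by rewrite -[LHS](addKr (c ^+ 2)%R) cs; ring.
    by rewrite -mulNr mulfK // opprB.
  have tc : (t * c = - s - t)%R.
    have -> : (t * c = t * (1 + c) - t)%R by ring.
    by rewrite /t mulNr divfK.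
  congr pair.
    have -> : (x + t * y + t * (y + s * (x + t * y)) =
      x + 2 * t * y + (t * s) * x + t * (t * s) * y)%R by ring.
    rewrite ts (_ : (t * (c - 1) * y = (t * c - t) * y)%R); last by ring.
    by rewrite tc; ring.
  have -> : (y + s * (x + t * y) = s * x + y + (t * s) * y)%R by ring.
  by rewrite ts; ring.
transitivity (\int[mu]_x \int[mu]_y (G \o shear1 t \o shear2 s) (shear1 t (x, y))).
  by apply: eq_integral => x _; apply: eq_integral => y _; rewrite E.
have mG1 : measurable_fun setT (G \o shear1 t).
  exact: (measurableT_comp mG (measurable_shear1 t)).
have mG2 : measurable_fun setT (G \o shear1 t \o shear2 s).
  exact: (measurableT_comp mG1 (measurable_shear2 s)).
rewrite (integral_shear1 t mG2 (fun z => G0 _)).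
rewrite (integral_shear2 mG1 (fun z => G0 _)).
exact: integral_shear1.
Qed.

Lemma integral_rot (c s : R) (G : mR * mR -> \bar R) : (c ^+ 2 + s ^+ 2 = 1)%R ->
  measurable_fun setT G -> (forall z, 0 <= G z) ->
  \int[mu]_x \int[mu]_y G (plane_rot c s (x, y)) = \int[mu]_x \int[mu]_y G (x, y).
Proof.
move=> cs mG G0; have [c1|c1] := eqVneq c (-1)%R; last first.
  exact: (integral_rot_neqN1 cs c1 mG G0).
have s0 : (s = 0)%R.
  apply/eqP; rewrite -sqrf_eq0; apply/eqP; rewrite c1 in cs.
  by apply: (@addrI _ ((-1) ^+ 2)%R); rewrite cs addr0 sqrrN expr1n.
(* The half turn is the quarter turn [(c, s) = (0, 1)] performed twice. *)
have q : (0 ^+ 2 + 1 ^+ 2 = 1 :> R)%R by rewrite expr0n expr1n add0r.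
have n1 : (0 != -1 :> R)%R by rewrite eq_sym oppr_eq0 oner_eq0.
rewrite -[RHS](integral_rot_neqN1 q n1) //.
have mG1 : measurable_fun setT (G \o plane_rot 0 1).
  exact: (measurableT_comp mG (measurable_rot 0 1)).
rewrite -[RHS](integral_rot_neqN1 q n1 mG1 (fun z => G0 _)).
apply: eq_integral => x _; apply: eq_integral => y _ /=.
by rewrite /plane_rot c1 s0 /=; congr (G (_, _)); ring.
Qed.

(** The density depends on [x^2 + y^2] only, so it may be evaluated at the rotated point; the claim
    is then [integral_rot] for indicator times density. *)
Lemma mpres_rot (c s : R) : (c ^+ 2 + s ^+ 2 = 1)%R ->
  mpres (plane_rot c s : pprod gaussR gaussR -> pprod gaussR gaussR).
Proof.
move=> cs; split => [|A mA]; first exact: measurable_rot.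
have mrA : measurable (plane_rot c s @^-1` A).
  by rewrite -[X in measurable X]setTI; exact: measurable_rot.
rewrite !gauss2E //.
rewrite -(integral_rot (G := fun z => (\1_A z * gauss2_pdf z)%:E) cs).
- apply: eq_integral => x _; apply: eq_integral => y _.
  congr EFin; congr (_ * _)%R.
  rewrite /gauss2_pdf /plane_rot /=; congr (_ * expR (- _))%R.
  rewrite -[LHS]mul1r -cs; ring.
- apply/measurable_EFinP; apply: measurable_funM.
    exact: measurable_indic.
  exact: measurable_gauss2_pdf.
- by move=> z; rewrite lee_fin mulr_ge0 // gauss2_pdf_ge0.
Qed.

End gauss_plane.

(** * Law of the squared norm of a complex Gaussian vector *)

Lemma measurable_sublevel d (T : measurableType d) (R : realType) (f : T -> R) (x : R) :
  measurable_fun setT f -> measurable [set t | f t < x].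
Proof.
move=> mf; rewrite -[X in measurable X]setTI.
have -> : [set t | f t < x] = f @^-1` `]-oo, x[%classic.
  by apply/seteqP; split => t /=; rewrite in_itv.
by apply: mf => //; exact: measurable_itv.
Qed.

Section disc_law.
Variable R : realType.
Local Notation mR := (measurableTypeR R).
Local Notation mu := (@lebesgue_measure R).
Local Open Scope ereal_scope.

Definition gaussC : pspace R := pprod (gaussR R) (gaussR R).

Definition nrmC (z : gaussC) : R := (z.1 ^+ 2 + z.2 ^+ 2)%R.

Lemma measurable_nrmC : measurable_fun setT nrmC.
Proof.
by apply: measurable_funD; apply: measurable_funX;
  [exact: measurable_fst|exact: measurable_snd].
Qed.

Lemma ge0_even_integralT (f : mR -> \bar R) : measurable_fun setT f ->
  (forall x, 0 <= f x) -> (forall x, f (- x)%R = f x) ->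
  \int[mu]_x f x = 2%:E * \int[mu]_(x in `[0%R, +oo[) f x.
Proof.
move=> mf f0 fe.
have -> : [set: mR] = `]-oo, 0%R[%classic `|` `[0%R, +oo[%classic.
  by apply/seteqP; split => // x _ /=; rewrite !in_itv/= andbT; case: ltP; [left|right].
rewrite ge0_integral_setU //=; last 2 first.
- exact: measurable_funTS.
- apply/disj_setPS => x /=; rewrite !in_itv/= andbT => -[h1 h2].
  by have := lt_le_trans h1 h2; rewrite ltxx.
rewrite integral_itv_bndo_bndc; last exact: measurable_funTS.
have -> : \int[mu]_(x in `]-oo, 0%R]) f x = \int[mu]_(x in `]-oo, 0%R]) f (- x)%R.
  by apply: eq_integral => x _; rewrite fe.
by rewrite -ge0_integration_by_substitution0 // -mule2n -mule_natl.
Qed.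

(** The integral over the slope [s] in [gaussC_disc]; it cancels the factor [pi^-1] of the
    density. *)
Lemma integralT_oneDsqrV : \int[mu]_x ((1 + x ^+ 2)^-1)%:E = (pi : R)%:E.
Proof.
have c1 : continuous (fun x : R => (1 + x ^+ 2)^-1)%R := @continuous_oneDsqrV R.
rewrite ge0_even_integralT.
- rewrite (@ge0_continuous_FTC2y _ _ (@atan R) 0 (pi / 2)%R).
  + by rewrite atan0 sube0 -EFinM mulrCA divff // mulr1.
  + by move=> x _; rewrite invr_ge0 addr_ge0 // sqr_ge0.
  + exact: continuous_subspaceT.
  + exact: cvgy_atan.
  + by move=> x _; exact: derivable_atan.
  + by apply: cvg_at_right_filter; exact: continuous_atan.
  + by move=> x _; exact: derive1_atan.
- by apply/measurable_EFinP; exact: continuous_measurable_fun.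
- by move=> x; rewrite lee_fin invr_ge0 addr_ge0 // sqr_ge0.
- by move=> x; rewrite sqrrN.
Qed.

(** The radial integral of [gaussC_disc], where [w = 1 + s^2]. The factor [|a|] gives the integrand
    an elementary antiderivative on the half line. *)
Lemma integral_absM_expR_disc (w x : R) : (0 < w)%R -> (0 < x)%R ->
  \int[mu]_a (`|a| * (\1_[set a : R | a ^+ 2 * w < x]%R a * expR (- (a ^+ 2 * w))))%:E
  = ((1 - expR (- x)) / w)%:E.
Proof.
move=> w0 x0; set f := (X in \int[mu]_a X a).
pose r : R := Num.sqrt (x / w).
have r0 : (0 < r)%R by rewrite sqrtr_gt0 divr_gt0.
have rE (a : R) : (0 <= a)%R -> (a ^+ 2 * w < x)%R = (a < r)%R.
  move=> a0; rewrite -ltr_pdivlMr // -[in LHS](@sqr_sqrtr _ (x / w)%R); last first.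
    by rewrite divr_ge0 // ltW.
  by rewrite ltr_pXn2r // nnegrE // ltW.
pose g (a : R) : R := (a * expR (- (a ^+ 2 * w)))%R.
pose F (a : R) : R := (- ((2 * w)^-1 * expR (- (a ^+ 2 * w))))%R.
have cg : continuous g.
  move=> a; apply: cvgM; first exact: cvg_id.
  apply: (cvg_comp _ (@expR R)); last exact: continuous_expR.
  apply: (@cvgN _ R^o); apply: cvgM; last exact: cvg_cst.
  exact: exprn_continuous.
have dF (a : R) : is_derive a (1 : R)%R F (g a).
  have h1 : is_derive a (1 : R)%R (fun a : R => - (a ^+ 2 * w))%R (- (2 * a * w))%R.
    apply: is_derive_eq; rewrite /GRing.scale /=; ring.
  have h2 := @is_derive1_comp _ (@expR R) _ a _ _ (is_derive_expR _) h1.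
  have -> : F = (- ((2 * w)^-1 *: (@expR R \o (fun a : R => - (a ^+ 2 * w)))))%R by [].
  apply: is_derive_eq; rewrite /g /GRing.scale /=; field.
  by rewrite gt_eqF.
have mdisc : measurable [set a : mR | (a ^+ 2 * w < x)%R].
  by apply: measurable_sublevel; apply: measurable_funM.
rewrite ge0_even_integralT; last 3 first.
- apply/measurable_EFinP; apply: measurable_funM; first exact: normr_measurable.
  apply: measurable_funM; first exact: measurable_indic.
  apply: measurableT_comp => //; apply: measurableT_comp => //.
  by apply: measurable_funM.
- by move=> a; rewrite lee_fin !mulr_ge0 // expR_ge0.
- by move=> a; rewrite /f !indicE normrN !sqrrN /in_mem /= /in_set /= sqrrN.
have -> : \int[mu]_(a in `[0%R, +oo[) f a = \int[mu]_(a in `[0%R, r[) (g a)%:E.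
  have -> : `[0%R, r[%classic = `[0%R, +oo[%classic `&` `]-oo, r[%classic :> set mR.
    by apply/seteqP; split => a /=; rewrite !in_itv/= andbT; [move/andP|move=> [-> ->]].
  rewrite integral_mkcondr; apply: eq_integral => a; rewrite inE /= in_itv/= andbT => a0.
  rewrite /f /g ger0_norm // indicE patchE.
  have -> : (a \in [set a : R | a ^+ 2 * w < x]%R) = (a \in `]-oo, r[%classic).
    by apply/idP/idP; rewrite !inE /= in_itv /= rE.
  by case: (_ \in _); rewrite ?mul1r // mul0r mulr0.
rewrite integral_itv_bndo_bndc; last first.
  by apply: measurable_funTS; apply/measurable_EFinP; exact: continuous_measurable_fun.
rewrite (@continuous_FTC2 _ g F 0 r r0).
- rewrite /F expr0n mul0r oppr0 expR0 sqr_sqrtr ?divr_ge0 ?ltW //.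
  rewrite divfK ?gt_eqF // -EFinB -EFinM; congr EFin.
  by field; rewrite gt_eqF.
- exact: continuous_subspaceT.
- have cF : continuous F.
    move=> a; apply: differentiable_continuous; apply/derivable1_diffP.
    exact: (@ex_derive _ _ _ _ _ _ _ (dF a)).
  split => [a _||]; first exact: (@ex_derive _ _ _ _ _ _ _ (dF a)).
    by apply: cvg_at_right_filter; exact: cF.
  by apply: cvg_at_left_filter; exact: cF.
- by move=> a _; rewrite derive1E; exact: derive_val.
Qed.

(** Slopes replace polar coordinates: [y = a s] for fixed [a] has Jacobian [|a|] and
    [a^2 + y^2 = a^2 (1 + s^2)]. After exchanging the integrals, the one over [a] gives
    [(1 - e^-x) / (pi (1 + s^2))], and the one over [s] removes [pi]. *)
Lemma gaussC_disc (x : R) : (0 < x)%R ->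
  plaw gaussC [set z | (nrmC z < x)%R] = (1 - expR (- x))%:E.
Proof.
move=> x0; set D := (X in plaw gaussC X).
have mD : measurable D by exact: (measurable_sublevel _ measurable_nrmC).
rewrite gauss2E //.
pose K (z : mR * mR) := (\1_D z * gauss2_pdf z)%:E.
have mK : measurable_fun setT K.
  apply/measurable_EFinP; apply: measurable_funM; first exact: measurable_indic.
  exact: measurable_gauss2_pdf.
have K0 z : 0 <= K z by rewrite lee_fin mulr_ge0 // gauss2_pdf_ge0.
pose K' (z : mR * mR) := `|z.1|%:E * K (z.1, (z.1 * z.2)%R).
have mf : measurable_fun setT (@fst mR mR) by exact: measurable_fst.
have ms : measurable_fun setT (@snd mR mR) by exact: measurable_snd.
have mK' : measurable_fun setT K'.
  apply: emeasurable_funM.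
    by apply/measurable_EFinP; apply: measurableT_comp => //; exact: normr_measurable.
  apply: (measurableT_comp mK); apply: measurable_fun_pair => //.
  exact: measurable_funM.
have K'0 z : 0 <= K' z by rewrite mule_ge0.
transitivity (\int[mu]_a \int[mu]_s K' (a, s)).
  apply: ae_eq_integral => //.
  - exact: (@measurable_fun_fubini_tonelli_F _ _ _ _ R mu K mK K0).
  - exact: (@measurable_fun_fubini_tonelli_F _ _ _ _ R mu K' mK' K'0).
  (* The substitution degenerates only at [a = 0], a null set. *)
  exists [set 0%R]; split => //; first exact: lebesgue_measure_set1.
  move=> a /= h; apply: contrapT => a0; apply: h => _.
  have {}a0 : a != 0%R by apply/eqP.
  have mKa : measurable_fun setT (fun y => K (a, y)).
    by apply: measurableT_comp => //; exact: pair1_measurable.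
  rewrite -(ge0_integral_scale a0 mKa (fun y => K0 _)).
  rewrite -ge0_integralZl //=.
  apply: (measurableT_comp mKa); exact: measurable_funM.
rewrite (integral_swap mK' K'0).
transitivity (\int[mu]_s ((pi^-1 * (1 - expR (- x)))%:E * ((1 + s ^+ 2)^-1)%:E)).
  apply: eq_integral => s _.
  have w0 : (0 < 1 + s ^+ 2)%R by rewrite ltr_pwDl // sqr_ge0.
  rewrite -EFinM -mulrA EFinM -(integral_absM_expR_disc w0 x0).
  rewrite -ge0_integralZl //=.
  - apply: eq_integral => a _; rewrite /K' /K /gauss2_pdf /= -!EFinM; congr EFin.
    rewrite !indicE; have aE : (a ^+ 2 + (a * s) ^+ 2 = a ^+ 2 * (1 + s ^+ 2))%R by ring.
    have -> : ((a, a * s)%R \in D) = (a \in [set a : R | a ^+ 2 * (1 + s ^+ 2) < x]%R).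
      by apply/idP/idP; rewrite !inE /D /nrmC /= aE.
    by rewrite aE; ring.
  - apply/measurable_EFinP; apply: measurable_funM; first exact: normr_measurable.
    apply: measurable_funM.
      by apply: measurable_indic; apply: measurable_sublevel; apply: measurable_funM.
    apply: measurableT_comp => //; apply: measurableT_comp => //.
    by apply: measurable_funM.
  - by rewrite lee_fin invr_ge0 pi_ge0.
rewrite ge0_integralZl //=.
- by rewrite integralT_oneDsqrV -EFinM mulrAC mulVf ?mul1r // gt_eqF // pi_gt0.
- apply/measurable_EFinP; apply: continuous_measurable_fun.
  exact: (@continuous_oneDsqrV R).
- by move=> s _; rewrite lee_fin invr_ge0 addr_ge0 // sqr_ge0.
- rewrite lee_fin mulr_ge0 ?invr_ge0 ?pi_ge0 // subr_ge0 -expR0 ler_expR.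
  by rewrite oppr_le0 ltW.
Qed.

End disc_law.

(** * Gamma law of a sum of independent exponential variables *)

Section gamma_law.
Variable R : realType.
Local Notation mR := (measurableTypeR R).
Local Notation mu := (@lebesgue_measure R).
Local Notation gaussC := (gaussC R).

(** On [t >= 0], the density of the Gamma law of shape [n + 1]. *)
Definition gamma_dens (n : nat) (t : R) : R := t ^+ n * expR (- t) / n`!%:R.

Lemma continuous_gamma_dens n : continuous (gamma_dens n).
Proof.
move=> t; apply: cvgM; last exact: cvg_cst.
apply: cvgM; first exact: exprn_continuous.
by apply: (cvg_comp _ (@expR R)); [apply: (@cvgN _ R^o); exact: cvg_id|exact: continuous_expR].
Qed.

Lemma measurable_gamma_dens n : measurable_fun setT (gamma_dens n : mR -> mR).
Proof. by apply: continuous_measurable_fun; exact: continuous_gamma_dens. Qed.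

Lemma gamma_dens_ge0 n t : 0 <= t -> 0 <= gamma_dens n t.
Proof. by move=> t0; rewrite !mulr_ge0 ?exprn_ge0 ?expR_ge0 ?invr_ge0. Qed.

Local Open Scope ereal_scope.

Lemma Gamma_incE (x : R) n :
  (Gamma_inc x n.+1)%:E = \int[mu]_(t in `[0%R, x]) (gamma_dens n t)%:E.
Proof.
have ci : mu.-integrable `[0%R, x] (EFin \o (fun t : R => t ^+ n * expR (- t))%R).
  apply: continuous_compact_integrable; first exact: segment_compact.
  apply: continuous_subspaceT => t; apply: cvgM; first exact: exprn_continuous.
  by apply: (cvg_comp _ (@expR R)); [apply: (@cvgN _ R^o); exact: cvg_id|exact: continuous_expR].
rewrite /Gamma_inc /= EFinM fineK; last exact: integrable_fin_num.
rewrite -integralZl //; apply: eq_integral => t _ /=.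
by rewrite -EFinM mulrC.
Qed.

Lemma Gamma_inc_ge0 (x : R) n : (0 <= Gamma_inc x n.+1)%R.
Proof.
rewrite -lee_fin Gamma_incE; apply: integral_ge0 => t /=.
by rewrite in_itv/= lee_fin => /andP[t0 _]; exact: gamma_dens_ge0.
Qed.

Lemma Gamma_inc_le (x y : R) n : (x <= y)%R ->
  (Gamma_inc x n.+1 <= Gamma_inc y n.+1)%R.
Proof.
move=> xy; rewrite -lee_fin !Gamma_incE; apply: ge0_subset_integral => //.
- by apply: measurable_funTS; apply/measurable_EFinP; exact: measurable_gamma_dens.
- by move=> t /=; rewrite in_itv/= lee_fin => /andP[t0 _]; exact: gamma_dens_ge0.
- by apply: subset_itvl; rewrite bnd_simp.
Qed.

Lemma Gamma_inc_le0 (x : R) n : (x <= 0)%R -> Gamma_inc x n.+1 = 0%R.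
Proof.
move=> x0; apply/eqP; rewrite -eqe Gamma_incE; apply/eqP.
have [xn|] := ltP x 0%R; first by rewrite set_itv_ge ?integral_set0 // bnd_simp -ltNge.
by move=> x0'; rewrite (@le_anti _ _ x 0%R) ?x0 // set_itv1 integral_set1.
Qed.

(* The two integrands differ by the derivative of
   t^(n+1) (e^-t - e^-x) / (n+1)!, which vanishes at both ends. *)
Lemma Gamma_inc_convol (x : R) n : (0 < x)%R ->
  \int[mu]_(t in `[0%R, x]) (gamma_dens n t * (1 - expR (- (x - t))))%:E =
  (Gamma_inc x n.+2)%:E.
Proof.
move=> x0.
pose F (t : R) : R := (gamma_dens n.+1 t - t ^+ n.+1 * expR (- x) / n.+1`!%:R)%R.
pose f (t : R) : R := (gamma_dens n t * (1 - expR (- (x - t))) - gamma_dens n.+1 t)%R.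
have cdens := continuous_gamma_dens.
have ce : continuous (fun t : R => expR (- (x - t)))%R.
  move=> t; apply: (cvg_comp _ (@expR R)); last exact: continuous_expR.
  by apply: (@cvgN _ R^o); apply: (@cvgB _ R^o); [exact: cvg_cst|exact: cvg_id].
have cg : continuous (fun t : R => gamma_dens n t * (1 - expR (- (x - t))))%R.
  move=> t; apply: cvgM; first exact: cdens.
  by apply: (@cvgB _ R^o); [exact: cvg_cst|exact: ce].
have cf : continuous f by move=> t; apply: (@cvgB _ R^o); [exact: cg|exact: cdens].
have dF (t : R) : is_derive t (1 : R)%R F (f t).
  have h1 : is_derive t (1 : R)%R (fun t : R => - t)%R (-1)%R.
    by apply: is_derive_eq.
  have h2 := @is_derive1_comp _ (@expR R) _ t _ _ (is_derive_expR _) h1.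
  have h3 : is_derive t (1 : R)%R (fun t : R => t ^+ n.+1)%R (n.+1%:R * t ^+ n)%R.
    have -> : (fun t : R => t ^+ n.+1)%R = ((@id R) ^+ n.+1)%R by rewrite exprfctE.
    by apply: is_derive_eq; rewrite /GRing.scale /= mulr1.
  pose p : R -> R := (fun t : R => t ^+ n.+1)%R.
  pose k : R := (n.+1`!%:R^-1)%R.
  have -> : F = (k *: (p * (@expR R \o (fun t : R => - t))) - (expR (- x) * k) *: p)%R.
    apply/funext => a; rewrite /F /gamma_dens !fctE /p /k /GRing.scale /=; ring.
  apply: is_derive_eq; rewrite /f /gamma_dens /p /k /GRing.scale /= factS natrM opprB.
  have -> : expR (t - x)%R = (expR t * expR (- x))%R by rewrite -expRD.
  have -> : expR t = (expR (- t))^-1%R by rewrite expRN invrK.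
  by field; rewrite ?gt_eqF ?expR_gt0 ?ltr0n ?fact_gt0.
have := @continuous_FTC2 _ f F 0 x x0.
have -> : (F x = 0)%R by rewrite /F /gamma_dens subrr.
have -> : (F 0 = 0)%R by rewrite /F /gamma_dens !expr0n /= !mul0r subrr.
rewrite sube0 => h.
have {}h : \int[mu]_(t in `[0%R, x]) (f t)%:E = 0.
  apply: h.
  - exact: continuous_subspaceT.
  - have cF : continuous F.
      move=> a; apply: differentiable_continuous; apply/derivable1_diffP.
      exact: (@ex_derive _ _ _ _ _ _ _ (dF a)).
    split => [a _||]; first exact: (@ex_derive _ _ _ _ _ _ _ (dF a)).
      by apply: cvg_at_right_filter; exact: cF.
    by apply: cvg_at_left_filter; exact: cF.
  - by move=> a _; rewrite derive1E; exact: derive_val.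
have ic (g : R -> R) : continuous g -> mu.-integrable `[0%R, x] (EFin \o g).
  move=> cg'; apply: continuous_compact_integrable; first exact: segment_compact.
  exact: continuous_subspaceT.
move: h; rewrite /f; under eq_integral do rewrite EFinB.
rewrite integralB //; [|exact: ic|exact: ic].
rewrite -Gamma_incE => /eqP; rewrite sube_eq ?add0e; first by move/eqP.
- by apply: integrable_fin_num => //; exact: ic.
- by rewrite fin_num_adde_defl.
Qed.

Fixpoint nrm2 q : ppow gaussC q -> R :=
  if q is q'.+1 then fun v => (nrmC v.1 + @nrm2 q' v.2)%R else fun=> 0%R.

Lemma measurable_nrm2 q : measurable_fun setT (@nrm2 q).
Proof.
elim: q => [|q IH]; first exact: measurable_cst.
apply: measurable_funD.
  by apply: (measurableT_comp (@measurable_nrmC R)); exact: measurable_fst.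
by apply: (measurableT_comp IH); exact: measurable_snd.
Qed.

Lemma nrmC_ge0 (z : gaussC) : (0 <= nrmC z)%R.
Proof. by rewrite addr_ge0 ?sqr_ge0. Qed.

Lemma nrm2_ge0 q (v : ppow gaussC q) : (0 <= nrm2 v)%R.
Proof. by elim: q v => //= q IH v; rewrite addr_ge0 ?nrmC_ge0. Qed.

Lemma gaussC_discE (x : R) :
  plaw gaussC [set z | (nrmC z < x)%R] = (if (0 < x)%R then 1 - expR (- x) else 0)%:E.
Proof.
case: ltP => [|x0]; first exact: gaussC_disc.
rewrite (_ : [set z | _] = set0) ?measure0 // -subset0 => z /= h.
by have := lt_le_trans (le_lt_trans (nrmC_ge0 z) h) x0; rewrite ltxx.
Qed.

Lemma Gamma_inc1 (x : R) :
  Gamma_inc x 1 = (if (0 < x)%R then 1 - expR (- x) else 0)%R.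
Proof.
case: ltP => [x0|]; last exact: Gamma_inc_le0.
apply/eqP; rewrite -eqe Gamma_incE; apply/eqP.
have h1 (t : R) : is_derive t (1 : R)%R (fun t : R => - t)%R (-1)%R.
  by apply: is_derive_eq.
have dF (t : R) : is_derive t (1 : R)%R
    (- (@expR R \o (fun t : R => - t)))%R (gamma_dens 0 t).
  have h2 := @is_derive1_comp _ (@expR R) _ t _ _ (is_derive_expR _) (h1 t).
  apply: is_derive_eq; rewrite /gamma_dens /GRing.scale /= fact0 invr1; ring.
have cF : continuous (- (@expR R \o (fun t : R => - t)))%R.
  move=> a; apply: differentiable_continuous; apply/derivable1_diffP.
  exact: (@ex_derive _ _ _ _ _ _ _ (dF a)).
rewrite (@continuous_FTC2 _ _ (- (@expR R \o (fun t : R => - t)))%R 0 x x0).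
- rewrite !fctE /= -EFinB; congr EFin; rewrite oppr0 expR0; ring.
- by apply: continuous_subspaceT; exact: continuous_gamma_dens.
- split => [a _||]; first exact: (@ex_derive _ _ _ _ _ _ _ (dF a)).
    by apply: cvg_at_right_filter; exact: cF.
  by apply: cvg_at_left_filter; exact: cF.
- by move=> a _; rewrite derive1E; exact: derive_val.
Qed.

(** By [gaussC_disc] each coordinate adds an independent exponential variable. For fixed first
    coordinate [z], the induction hypothesis is a Gamma density integrated up to [x - |z|^2];
    exchanging the integrals leaves the disc law for fixed [t], and [Gamma_inc_convol] concludes. *)
Lemma nrm2_law q (x : R) :
  plaw (ppow gaussC q.+1) [set v | (nrm2 v < x)%R] = (Gamma_inc x q.+1)%:E.
Proof.
elim: q x => [|q IH] x.
  rewrite Gamma_inc1 -gaussC_discE.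
  have -> : [set v : ppow gaussC 1 | (nrm2 v < x)%R] =
      [set z | (nrmC z < x)%R] `*` [set: punit R].
    by apply/seteqP; split => -[z u] /=; rewrite addr0 // => -[].
  rewrite (@plaw_prodE R gaussC (punit R)) ?probability_setT ?mule1 //.
  exact: (measurable_sublevel _ (@measurable_nrmC R)).
have [x0|x0] := leP x 0%R.
  rewrite Gamma_inc_le0 // (_ : [set v | _] = set0) ?measure0 // -subset0 => z /= h.
  by have := lt_le_trans (le_lt_trans (@nrm2_ge0 q.+2 z) h) x0; rewrite ltxx.
set A := (X in plaw _ X).
(* Domain of the double integral, with [t] standing for the squared norm of the tail. *)
pose B : set (gaussC * mR) := [set w | (0 <= w.2 /\ nrmC w.1 + w.2 < x)%R].
have mB : measurable B.
  have -> : B = snd @^-1` `[0%R, +oo[ `&` [set w | (nrmC w.1 + w.2 < x)%R].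
    by apply/seteqP; split => w /=; rewrite in_itv /= andbT.
  apply: measurableI.
    have ms : measurable_fun setT (@snd gaussC mR) by exact: measurable_snd.
    by rewrite -[X in measurable X]setTI; apply: ms => //; exact: measurable_itv.
  apply: measurable_sublevel; apply: measurable_funD; last exact: measurable_snd.
  by apply: (measurableT_comp (@measurable_nrmC R)); exact: measurable_fst.
pose K (w : gaussC * mR) := (\1_B w * gamma_dens q w.2)%:E.
have mK : measurable_fun setT K.
  apply/measurable_EFinP; apply: measurable_funM; first exact: measurable_indic.
  by apply: (measurableT_comp (@measurable_gamma_dens q)); exact: measurable_snd.
have K0 w : 0 <= K w.
  rewrite lee_fin indicE; have [|_] := boolP (w \in B); last by rewrite mul0r.
  by rewrite mul1r inE => -[w0 _]; exact: gamma_dens_ge0.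
transitivity (\int[plaw gaussC]_z \int[mu]_t K (z, t)).
  transitivity (\int[plaw gaussC]_z plaw (ppow gaussC q.+1) (xsection A z)) => //.
  apply: eq_integral => z _.
  have -> : xsection A z = [set v : ppow gaussC q.+1 | (nrm2 v < x - nrmC z)%R].
    by apply/seteqP; split => v; rewrite /xsection /= inE /A /= ltrBrDl.
  rewrite IH Gamma_incE -integral_itv_bndo_bndc; last first.
    by apply: measurable_funTS; apply/measurable_EFinP; exact: measurable_gamma_dens.
  rewrite integral_mkcond; apply: eq_integral => t _.
  rewrite patchE /K indicE /=.
  have -> : (t \in `[0%R, (x - nrmC z)%R[%classic) = ((z, t) \in B).
    apply/idP/idP; rewrite !inE /B /= in_itv /= ltrBrDl; first by move/andP.
    by case=> -> ->.
  by case: (_ \in B); rewrite ?mul1r ?mul0r.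
rewrite (@fubini_tonelli _ _ _ _ R (plaw gaussC) mu K mK K0).
rewrite -Gamma_inc_convol // -integral_itv_bndo_bndc; last first.
  apply: measurable_funTS; apply/measurable_EFinP; apply: measurable_funM.
    exact: measurable_gamma_dens.
  apply: measurable_funB => //; apply: measurableT_comp => //.
  by apply: measurableT_comp => //; exact: measurable_funB.
rewrite [RHS]integral_mkcond; apply: eq_integral => t _.
rewrite /fubini_G patchE.
have -> : \int[plaw gaussC]_z K (z, t) =
   \int[plaw gaussC]_z ((if (0 <= t)%R then gamma_dens q t else 0%R)%:E *
     (\1_[set z | (nrmC z < x - t)%R] z)%:E).
  apply: eq_integral => z _; rewrite /K -EFinM; congr EFin; rewrite !indicE /=.
  have -> : ((z, t) \in B) = (0 <= t)%R && (z \in [set z | (nrmC z < x - t)%R]).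
    apply/idP/idP; rewrite !inE /B /=.
      by move=> [-> ?]; rewrite andTb inE /= ltrBrDr.
    by move=> /andP[? ]; rewrite inE /= ltrBrDr.
  by case: (0 <= t)%R => /=; rewrite ?mul0r // mulrC.
have mD := measurable_sublevel (x - t) (@measurable_nrmC R).
rewrite ge0_integralZl //; last 2 first.
- by apply/measurable_EFinP; exact: measurable_indic.
- by case: ifPn => // t0; rewrite lee_fin gamma_dens_ge0.
rewrite integral_indic // setIT.
transitivity ((if (0 <= t)%R then gamma_dens q t else 0%R)%:E *
    (if (0 < x - t)%R then 1 - expR (- (x - t)) else 0)%R%:E).
  by congr (_ * _); exact: gaussC_discE.
rewrite subr_gt0.
rewrite (_ : (t \in `[0%R, x[%classic) = (0 <= t)%R && (t < x)%R); last first.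
  by apply/idP/idP; rewrite !inE /= in_itv.
by case: (0 <= t)%R; case: (t < x)%R; rewrite -?EFinM ?mul0r ?mulr0.
Qed.

End gamma_law.

(** * Isometries preserving the Gaussian measure *)

Section isometries.
Variable R : realType.
Local Notation gaussC := (gaussC R).
Local Notation C := R[i].

Lemma mpres_assocr (X Y Z : pspace R) :
  mpres ((fun z => (z.1.1, (z.1.2, z.2))) :
    pprod (pprod X Y) Z -> pprod X (pprod Y Z)).
Proof.
have dm := @determining_measurable R.
apply: (mpres_determining (determining_prod (dm X) (determining_prod (dm Y) (dm Z)))).
  apply: measurable_pair; first by do 2 apply: measurableT_comp => //.
  by apply: measurable_pair => //; do 2 apply: measurableT_comp => //.
move=> _ [A [_ [mA [B [E [mB mE ->]]] ->]]].
have -> : (fun z : pprod (pprod X Y) Z => (z.1.1, (z.1.2, z.2))) @^-1`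
    (A `*` (B `*` E)) = (A `*` B) `*` E.
  by apply/seteqP; split => -[[? ?] ?] /=; tauto.
have mX := @measurableX.
by rewrite !plaw_prodE //; [rewrite muleA|exact: mX|exact: mX].
Qed.

Lemma mpres_assocl (X Y Z : pspace R) :
  mpres ((fun z => ((z.1, z.2.1), z.2.2)) :
    pprod X (pprod Y Z) -> pprod (pprod X Y) Z).
Proof.
have dm := @determining_measurable R.
apply: (mpres_determining (determining_prod (determining_prod (dm X) (dm Y)) (dm Z))).
  apply: measurable_pair; last by do 2 apply: measurableT_comp => //.
  by apply: measurable_pair => //; do 2 apply: measurableT_comp => //.
move=> _ [_ [E [[A [B [mA mB ->]]] mE ->]]].
have -> : (fun z : pprod X (pprod Y Z) => ((z.1, z.2.1), z.2.2)) @^-1`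
    ((A `*` B) `*` E) = A `*` (B `*` E).
  by apply/seteqP; split => -[? [? ?]] /=; tauto.
have mX := @measurableX.
by rewrite !plaw_prodE //; [rewrite muleA|exact: mX|exact: mX].
Qed.

Definition toC (z : gaussC) : C := Complex z.1 z.2.

Fixpoint rowof q : ppow gaussC q -> 'rV[C]_q :=
  if q is q'.+1 then fun v => row_mx ((toC v.1)%:M : 'M[C]_1) (@rowof q' v.2)
  else fun=> 0.

Fixpoint matof q p : ppow (ppow gaussC q) p -> 'M[C]_(p, q) :=
  if p is p'.+1 then fun W => col_mx (rowof W.1) (@matof q p' W.2)
  else fun=> 0.

Fixpoint pzero q : ppow gaussC q :=
  if q is q'.+1 then ((0, 0), pzero q') else tt.

Lemma rowof0 q : rowof (pzero q) = 0.
Proof.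
elim: q => //= q ->.
have -> : toC (0, 0) = 0 by [].
by rewrite raddf0 (@row_mx0 _ 1 1 q).
Qed.

(** A unitary map as the proof sees it: it keeps the Gaussian law, and it keeps the Hermitian
    products that make up a Gram matrix. *)
Definition isometry q (U : ppow gaussC q -> ppow gaussC q) :=
  mpres U /\ forall v w, rowof (U v) *m ctrmx (rowof (U w)) =
                         rowof v *m ctrmx (rowof w).

Lemma isometry_comp q (U V : ppow gaussC q -> ppow gaussC q) :
  isometry U -> isometry V -> isometry (V \o U).
Proof.
move=> [mU hU] [mV hV]; split; first exact: mpres_comp.
by move=> v w; rewrite /= hV hU.
Qed.

Lemma dot_rowofS q (v w : ppow gaussC q.+1) :
  rowof v *m ctrmx (rowof w) =
  (toC v.1 * (toC w.1)^*)%:M + rowof v.2 *m ctrmx (rowof w.2).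
Proof.
rewrite /= (@ctrmx_row R 1 1 q) (@mul_row_col _ 1 1 q 1) ctrmx_scalar.
by rewrite -scalar_mxM.
Qed.

(** Rotating the plane of the first coordinate is multiplication by the unit complex number
    [c + i s]. *)
Lemma isometry_phase q (c s : R) : c ^+ 2 + s ^+ 2 = 1 ->
  isometry ((fun v => (plane_rot c s v.1, v.2)) : ppow gaussC q.+1 -> ppow gaussC q.+1).
Proof.
move=> cs; split.
  exact: (mpres_prod (mpres_rot cs) (@mpres_id R (ppow gaussC q))).
move=> v w; rewrite !dot_rowofS /=; congr (_%:M + _).
have E z : toC (plane_rot c s z) = Complex c s * toC z.
  by rewrite /toC /plane_rot /=; apply/eqP; rewrite eq_complex /= !eqxx /= addrC.
rewrite !E rmorphM /= mulrACA.
have -> : Complex c s * (Complex c s)^* = 1.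
  apply/eqP; rewrite eq_complex /=; apply/andP; split; apply/eqP; last by ring.
  by rewrite -cs; ring.
by rewrite mul1r.
Qed.

Lemma isometry_tail q (U : ppow gaussC q -> ppow gaussC q) : isometry U ->
  isometry ((fun v => (v.1, U v.2)) : ppow gaussC q.+1 -> ppow gaussC q.+1).
Proof.
move=> [mU hU]; split; first exact: (mpres_prod (@mpres_id R gaussC) mU).
by move=> v w; rewrite !dot_rowofS /= hU.
Qed.

Definition pair_rot (c s : R) (z : gaussC * gaussC) : gaussC * gaussC :=
  ((c * z.1.1 - s * z.2.1, c * z.1.2 - s * z.2.2),
   (s * z.1.1 + c * z.2.1, s * z.1.2 + c * z.2.2)).

(** Once real parts are grouped together and imaginary parts together, the map is the same plane
    rotation on each group. *)
Lemma mpres_rot2 (c s : R) : c ^+ 2 + s ^+ 2 = 1 ->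
  mpres (pair_rot c s : pprod gaussC gaussC -> pprod gaussC gaussC).
Proof.
move=> cs; have sw := @mpres_swap_inner R (gaussR R) (gaussR R) (gaussR R) (gaussR R).
have r := mpres_rot cs.
exact: (mpres_comp (mpres_comp sw (mpres_prod r r)) sw).
Qed.

Lemma isometry_rot2 q (c s : R) : c ^+ 2 + s ^+ 2 = 1 ->
  isometry ((fun v => let z := pair_rot c s (v.1, v.2.1) in (z.1, (z.2, v.2.2))) :
    ppow gaussC q.+2 -> ppow gaussC q.+2).
Proof.
move=> cs; split.
  have al := @mpres_assocl gaussC gaussC (ppow gaussC q).
  have ar := @mpres_assocr gaussC gaussC (ppow gaussC q).
  exact: (mpres_comp (mpres_comp al
    (mpres_prod (mpres_rot2 cs) (@mpres_id R (ppow gaussC q)))) ar).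
move=> [[x1 y1] [[x2 y2] v]] [[x1' y1'] [[x2' y2'] w]].
rewrite !dot_rowofS /= !addrA; congr (_ + _); rewrite -!raddfD; congr (_%:M).
apply/eqP; rewrite eq_complex /=; apply/andP; split; apply/eqP.
  have -> : x1 * x1' - y1 * - y1' + (x2 * x2' - y2 * - y2') =
    (c ^+ 2 + s ^+ 2) * (x1 * x1' - y1 * - y1' + (x2 * x2' - y2 * - y2')).
    by rewrite cs mul1r.
  ring.
have -> : x1 * - y1' + y1 * x1' + (x2 * - y2' + y2 * x2') =
  (c ^+ 2 + s ^+ 2) * (x1 * - y1' + y1 * x1' + (x2 * - y2' + y2 * x2')).
  by rewrite cs mul1r.
ring.
Qed.

Lemma rot_to_axis (x y : R) : exists c s : R, [/\ c ^+ 2 + s ^+ 2 = 1,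
  c * x - s * y = Num.sqrt (x ^+ 2 + y ^+ 2) & s * x + c * y = 0].
Proof.
set n := x ^+ 2 + y ^+ 2; have n0 : 0 <= n by rewrite addr_ge0 ?sqr_ge0.
have [nz|nz] := eqVneq n 0.
  exists 1, 0; move/eqP: (nz); rewrite paddr_eq0 ?sqr_ge0 // !sqrf_eq0.
  move=> /andP[/eqP -> /eqP ->]; rewrite nz sqrtr0.
  by split; rewrite ?expr1n ?expr0n ?mulr0 ?mul0r ?addr0 ?subr0.
set r := Num.sqrt n; have rr : r ^+ 2 = n by rewrite sqr_sqrtr.
have r0 : r != 0 by rewrite -sqrf_eq0 rr.
exists (x / r), (- y / r); split.
- have -> : (x / r) ^+ 2 + (- y / r) ^+ 2 = n / r ^+ 2 by rewrite /n; field.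
  by rewrite rr divff.
- have -> : x / r * x - - y / r * y = n / r by rewrite /n; field.
  by rewrite -rr expr2 mulfK.
- by field.
Qed.

(** A phase makes the first coordinate real and nonnegative, the induction hypothesis sends the tail
    to its norm on one axis, and a real rotation of these two coordinates merges both norms. *)
Lemma isometry_to_axis q (a : ppow gaussC q.+1) :
  exists U : ppow gaussC q.+1 -> ppow gaussC q.+1,
    isometry U /\ U a = ((Num.sqrt (nrm2 a), 0), pzero q).
Proof.
elim: q a => [|q IH] [[x y] a].
  have [c [s [cs h1 h2]]] := rot_to_axis x y.
  exists (fun v => (plane_rot c s v.1, v.2)); split; first exact: isometry_phase.
  by case: a; rewrite /plane_rot /= h1 h2 /nrmC /= addr0.
have [U [iU Ua]] := IH a.
have [c [s [cs h1 h2]]] := rot_to_axis x y.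
have [c' [s' [cs' h1' h2']]] :=
  rot_to_axis (Num.sqrt (x ^+ 2 + y ^+ 2)) (Num.sqrt (@nrm2 R q.+1 a)).
have := isometry_comp (isometry_comp (isometry_phase q.+1 cs) (isometry_tail iU))
  (isometry_rot2 q cs').
set V := (X in isometry X) => iV; exists V; split => //.
have -> : V ((x, y), a) = (let z := pair_rot c' s' (plane_rot c s (x, y), (U a).1) in
  (z.1, (z.2, (U a).2))) by [].
rewrite Ua /plane_rot /pair_rot /= h1 h2 h1' h2' !mulr0 subrr addr0.
by rewrite !sqr_sqrtr ?(@nrm2_ge0 R q.+1) ?addr_ge0 ?sqr_ge0.
Qed.

(** The two matrices and their heights are independent, so that each can be peeled row by row. *)
Lemma gram_matof q p p' (U : ppow gaussC q -> ppow gaussC q) : isometry U ->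
  forall (W : ppow (ppow gaussC q) p) (Z : ppow (ppow gaussC q) p'),
  matof (ppow_map U W) *m ctrmx (matof (ppow_map U Z)) =
  matof W *m ctrmx (matof Z).
Proof.
move=> [_ hU].
have h (v : ppow gaussC q) r (Z : ppow (ppow gaussC q) r) :
    rowof (U v) *m ctrmx (matof (ppow_map U Z)) = rowof v *m ctrmx (matof Z).
  elim: r Z => [|r IH] Z; first by rewrite !ctrmx0 !mulmx0.
  rewrite [matof _]/= [matof Z]/= !(@ctrmx_col R 1 q r) !(@mul_mx_row _ _ _ 1 r).
  by rewrite IH hU.
elim: p => [|p IH] W Z; first by rewrite !mul0mx.
by rewrite [matof _]/= [matof W]/= !(@mul_col_mx _ 1 p) h IH.
Qed.

Definition rowtail q : ppow gaussC q.+1 -> ppow gaussC q := snd.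

(** The first column [w] stays unspecified: [detI_block_ge] holds for any [w]. *)
Lemma matof_split q p (W : ppow (ppow gaussC q.+1) p) : exists w : 'cV[C]_p,
  matof W = row_mx w (matof (ppow_map (@rowtail q) W)) :> 'M[C]_(p, 1 + q).
Proof.
elim: p W => [|p IH] W; first by exists 0; rewrite [LHS]flatmx0 [RHS]flatmx0.
have [w hw] := IH W.2.
exists (col_mx ((toC W.1.1)%:M : 'M[C]_1) w).
rewrite [LHS]/= hw.
exact: (@block_mxEh _ 1 p 1 q).
Qed.

(** [U] is chosen from [a] before [W] is given; only so is it, for a frozen [a], one law-preserving
    map applied to each remaining row. *)
Lemma detI_slice_ge q p (c : R) (a : ppow gaussC q.+1) : 0 <= c ->
  exists2 U : ppow gaussC q.+1 -> ppow gaussC q.+1, mpres U &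
  forall W : ppow (ppow gaussC q.+1) p,
  (1 + c * nrm2 a)%:C%C *
    detI c%:C%C (matof (ppow_map (@rowtail q) (ppow_map U W))) <=
  detI c%:C%C (@matof q.+1 p.+1 (a, W)).
Proof.
move=> c0; have [U [iU Ua]] := isometry_to_axis a; exists U; first by case: iU.
move=> W.
have -> : detI c%:C%C (@matof q.+1 p.+1 (a, W)) =
          detI c%:C%C (@matof q.+1 p.+1 (U a, ppow_map U W)).
  rewrite /detI; congr (\det (_ + _ *: _)).
  by rewrite -(@gram_matof _ p.+1 p.+1 U iU (a, W) (a, W)).
have [w hw] := matof_split (ppow_map U W).
have -> : @matof q.+1 p.+1 (U a, ppow_map U W) =
  block_mx ((Num.sqrt (nrm2 a))%:C%C%:M : 'M[C]_1) (0 : 'rV[C]_q) w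
    (matof (ppow_map (@rowtail q) (ppow_map U W))) :> 'M[C]_(1 + p, 1 + q).
  by rewrite [LHS]/= hw Ua /= rowof0.
have := @detI_block_ge R p q c%:C%C (Num.sqrt (nrm2 a))%:C%C w
  (matof (ppow_map (@rowtail q) (ppow_map U W))).
rewrite !ler0c => /(_ c0 (sqrtr_ge0 _)).
have -> : 1 + c%:C%C * (Num.sqrt (nrm2 a))%:C%C ^+ 2 = (1 + c * nrm2 a)%:C%C.
  by rewrite rmorphD rmorph1 rmorphM -rmorphXn /= sqr_sqrtr // (@nrm2_ge0 R q.+1).
by [].
Qed.

End isometries.

(** * The bound on the law of the determinant *)

Section complex_measurable.
Context (R : realType) (d : measure_display) (T : measurableType d).

Definition cmeasurable (f : T -> R[i]) : Prop :=
  measurable_fun setT (fun t => complex.Re (f t)) /\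
  measurable_fun setT (fun t => complex.Im (f t)).

Lemma cmeasurable_cst z : cmeasurable (fun=> z).
Proof. by split; exact: measurable_cst. Qed.

Lemma cmeasurableD f g : cmeasurable f -> cmeasurable g ->
  cmeasurable (fun t => f t + g t).
Proof.
move=> [f1 f2] [g1 g2].
split.
  rewrite (_ : (fun t => _) = (fun t => complex.Re (f t) + complex.Re (g t))).
    exact: measurable_funD.
  by apply/funext => t; case: (f t) => ? ?; case: (g t).
rewrite (_ : (fun t => _) = (fun t => complex.Im (f t) + complex.Im (g t))).
  exact: measurable_funD.
by apply/funext => t; case: (f t) => ? ?; case: (g t).
Qed.

Lemma cmeasurableM f g : cmeasurable f -> cmeasurable g ->
  cmeasurable (fun t => f t * g t).
Proof.
move=> [f1 f2] [g1 g2].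
split.
  rewrite (_ : (fun t => _) = (fun t =>
      complex.Re (f t) * complex.Re (g t) - complex.Im (f t) * complex.Im (g t))).
    by apply: measurable_funB; exact: measurable_funM.
  by apply/funext => t; case: (f t) => ? ?; case: (g t).
rewrite (_ : (fun t => _) = (fun t =>
    complex.Re (f t) * complex.Im (g t) + complex.Im (f t) * complex.Re (g t))).
  by apply: measurable_funD; exact: measurable_funM.
by apply/funext => t; case: (f t) => ? ?; case: (g t).
Qed.

Lemma cmeasurable_conj f : cmeasurable f -> cmeasurable (fun t => (f t)^*).
Proof.
move=> [f1 f2]; split.
  by rewrite (_ : (fun t => _) = (fun t => complex.Re (f t))) //;
    apply/funext => t; case: (f t).
rewrite (_ : (fun t => _) = (fun t => - complex.Im (f t))).
  exact: measurableT_comp.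
by apply/funext => t; case: (f t).
Qed.

Lemma cmeasurable_sum (I : Type) (s : seq I) (f : I -> T -> R[i]) :
  (forall i, cmeasurable (f i)) -> cmeasurable (fun t => \sum_(i <- s) f i t).
Proof.
move=> mf; elim: s => [|i s IH].
  by under eq_fun do rewrite big_nil; exact: cmeasurable_cst.
by under eq_fun do rewrite big_cons; exact: cmeasurableD.
Qed.

Lemma cmeasurable_prod (I : Type) (s : seq I) (f : I -> T -> R[i]) :
  (forall i, cmeasurable (f i)) -> cmeasurable (fun t => \prod_(i <- s) f i t).
Proof.
move=> mf; elim: s => [|i s IH].
  by under eq_fun do rewrite big_nil; exact: cmeasurable_cst.
by under eq_fun do rewrite big_cons; exact: cmeasurableM.
Qed.

Lemma cmeasurable_detI p q (c : R[i]) (M : T -> 'M[R[i]]_(p, q)) :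
  (forall i j, cmeasurable (fun t => M t i j)) ->
  cmeasurable (fun t => detI c (M t)).
Proof.
move=> mM; rewrite /detI /determinant; apply: cmeasurable_sum => s.
apply: cmeasurableM; first exact: cmeasurable_cst.
apply: cmeasurable_prod => i; under eq_fun do rewrite !mxE.
apply: cmeasurableD; first exact: cmeasurable_cst.
apply: cmeasurableM; first exact: cmeasurable_cst.
apply: cmeasurable_sum => k; under eq_fun do rewrite ctrmxE.
by apply: cmeasurableM => //; exact: cmeasurable_conj.
Qed.

End complex_measurable.

(** * Induction on the rows, one Gamma variable at a time *)

Section bartlett.
Variable R : realType.
Local Notation gaussC := (gaussC R).

Lemma cmeasurable_rowof q i j : cmeasurable (fun v : ppow gaussC q => rowof v i j).
Proof.
elim: q i j => [i []//|q IH] i j.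
rewrite /=; under eq_fun do rewrite mxE.
case: (@fintype.split 1 q j) => k.
  rewrite (ord1 i) (ord1 k); under eq_fun do rewrite mxE eqxx mulr1n.
  split => /=.
    exact: (measurableT_comp (@measurable_fst _ _ _ _) (@measurable_fst _ _ _ _)).
  exact: (measurableT_comp (@measurable_snd _ _ _ _) (@measurable_fst _ _ _ _)).
by have [m1 m2] := IH i k; split;
  [apply: (measurableT_comp m1)|apply: (measurableT_comp m2)]; exact: measurable_snd.
Qed.

Lemma cmeasurable_matof q p i j :
  cmeasurable (fun W : ppow (ppow gaussC q) p => matof W i j).
Proof.
elim: p i j => [[]//|p IH] i j.
rewrite /=; under eq_fun do rewrite mxE.
case: (@fintype.split 1 p i) => k.
  by have [m1 m2] := @cmeasurable_rowof q k j; split;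
    [apply: (measurableT_comp m1)|apply: (measurableT_comp m2)]; exact: measurable_fst.
by have [m1 m2] := IH k j; split;
  [apply: (measurableT_comp m1)|apply: (measurableT_comp m2)]; exact: measurable_snd.
Qed.

Variable c : R.
Hypothesis c0 : 0 < c.

Definition detre q p (W : ppow (ppow gaussC q) p) : R :=
  complex.Re (detI c%:C%C (matof W)).

Lemma measurable_detre q p : measurable_fun setT (@detre q p).
Proof. by have [] := cmeasurable_detI c%:C%C (@cmeasurable_matof q p). Qed.

Lemma measurable_detre_lt q p x : measurable [set W | @detre q p W < x].
Proof. by apply: measurable_sublevel; exact: measurable_detre. Qed.

Lemma detre_ge1 q p (W : ppow (ppow gaussC q) p) : 1 <= detre W.
Proof.
have : 1 <= detI c%:C%C (matof W) by apply: detI_ge1; rewrite ler0c ltW.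
by rewrite lecE => /andP[].
Qed.

(** The left event lies in the preimage of the right one under the map that applies [U] to every row
    and drops its first coordinate; that map preserves the law. *)
Lemma detre_slice q p (a : ppow gaussC q.+1) (x : R) :
  (plaw (ppow (ppow gaussC q.+1) p) [set W | (@detre q.+1 p.+1 (a, W) < x)%R] <=
   plaw (ppow (ppow gaussC q) p) [set W | ((1 + c * nrm2 a) * detre W < x)%R])%E.
Proof.
have [U mU hU] := @detI_slice_ge R q p c a (ltW c0).
have mf := mpres_comp (mpres_ppow_map p mU)
  (mpres_ppow_map p (@mpres_snd R gaussC (ppow gaussC q))).
have mS : measurable [set W : ppow (ppow gaussC q) p | (1 + c * nrm2 a) * detre W < x].
  by apply: measurable_sublevel; apply: measurable_funM => //; exact: measurable_detre.
rewrite -(mf.2 _ mS); apply: le_measure; rewrite ?inE.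
- apply: measurable_sublevel.
  apply: (measurableT_comp (@measurable_detre q.+1 p.+1)).
  exact: pair1_measurable.
- by rewrite -[X in measurable X]setTI; apply: mf.1.
move=> W /=; apply: le_lt_trans.
have := hU W; rewrite lecE => /andP[_]; rewrite /detre /=.
by case: (detI _ _) => u v /=; rewrite mul0r subr0.
Qed.

(* The probability that [1 + c X < y] for [X] of law [Gamma(n)]. *)
Definition gamma_cdf1D (y : R) (n : nat) : R := Gamma_inc ((y - 1) / c) n.

Lemma gamma_cdf1D_ge0 y n : (0 < n)%N -> 0 <= gamma_cdf1D y n.
Proof. by case: n => // n _; exact: Gamma_inc_ge0. Qed.

Lemma gamma_cdf1D_le y z n : (0 < n)%N -> y <= z -> gamma_cdf1D y n <= gamma_cdf1D z n.
Proof.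
by case: n => // n _ yz; apply: Gamma_inc_le; rewrite ler_pM2r ?invr_gt0 // lerD2r.
Qed.

Lemma nrm2_law1D q y :
  plaw (ppow gaussC q.+1) [set a | 1 + c * nrm2 a < y] = (gamma_cdf1D y q.+1)%:E.
Proof.
rewrite -nrm2_law; congr (plaw _ _); apply/seteqP; split => a /=;
  by rewrite ltr_pdivlMr // ltrBrDl mulrC.
Qed.

(** Integrates a slice bound that depends on [a] through two threshold indicators only, the shape
    produced by both inductions below. *)
Lemma integral_slice q p (x A B y z : R) : 0 <= A -> 0 <= B ->
  (forall a : ppow gaussC q.+1,
    (plaw (ppow (ppow gaussC q) p) [set W | ((1 + c * nrm2 a) * detre W < x)%R] <=
     (A * \1_[set a | (1 + c * nrm2 a < y)%R] a +
      B * \1_[set a | (1 + c * nrm2 a < z)%R] a)%:E)%E) ->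
  (plaw (ppow (ppow gaussC q.+1) p.+1) [set W | (detre W < x)%R] <=
   (A * gamma_cdf1D y q.+1 + B * gamma_cdf1D z q.+1)%:E)%E.
Proof.
move=> A0 B0 h.
pose E t : set (ppow gaussC q.+1) := [set a | 1 + c * nrm2 a < t].
have mE t : measurable (E t).
  apply: measurable_sublevel; apply: measurable_funD => //.
  by apply: measurable_funM => //; exact: measurable_nrm2.
have mA : measurable [set W | @detre q.+1 p.+1 W < x] by exact: measurable_detre_lt.
apply: (@le_trans _ _ (\int[plaw (ppow gaussC q.+1)]_a
    (A * \1_(E y) a + B * \1_(E z) a)%:E)%E).
  apply: ge0_le_integral => //.
  - exact: measurable_fun_xsection.
  - apply/measurable_EFinP; apply: measurable_funD; apply: measurable_funM => //;
      exact: measurable_indic.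
  move=> a _; apply: le_trans (h a); apply: le_trans (detre_slice _ _ _).
  rewrite /= (_ : xsection _ _ = [set W | @detre q.+1 p.+1 (a, W) < x]) //.
  by apply/seteqP; split => W; rewrite /xsection /= inE.
under eq_integral do rewrite EFinD !EFinM.
rewrite ge0_integralD //; last 4 first.
- by move=> a _; rewrite -EFinM lee_fin mulr_ge0.
- by apply: emeasurable_funM => //; apply/measurable_EFinP; exact: measurable_indic.
- by move=> a _; rewrite -EFinM lee_fin mulr_ge0.
- by apply: emeasurable_funM => //; apply/measurable_EFinP; exact: measurable_indic.
have hI K t : 0 <= K -> (\int[plaw (ppow gaussC q.+1)]_a (K%:E * (\1_(E t) a)%:E) =
    (K * gamma_cdf1D t q.+1)%:E)%E.
  move=> K0; rewrite ge0_integralZl //; last first.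
    by apply/measurable_EFinP; exact: measurable_indic.
  rewrite integral_indic // setIT EFinM; congr (_ * _)%E; exact: nrm2_law1D.
by rewrite !hI.
Qed.

Lemma measurable_kdetre_lt q p k x :
  measurable [set W : ppow (ppow gaussC q) p | k * detre W < x].
Proof.
by apply: measurable_sublevel; apply: measurable_funM => //; exact: measurable_detre.
Qed.

Lemma detre_le_kdetre q p k (W : ppow (ppow gaussC q) p) :
  1 <= k -> detre W <= k * detre W.
Proof. by move=> k1; rewrite ler_peMl // (le_trans ler01) // detre_ge1. Qed.

Lemma kdetre_lt_eq0 q p k x : 0 <= k -> x <= k ->
  plaw (ppow (ppow gaussC q) p) [set W | k * detre W < x] = 0%E.
Proof.
move=> k0 xk; rewrite (_ : [set W | _] = set0) ?measure0 // -subset0 => W /=.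
by rewrite ltNge (le_trans xk) // ler_peMr // detre_ge1.
Qed.

Lemma bartlett_bound_top p q (s : R) : (p <= q)%N ->
  (plaw (ppow (ppow gaussC q) p) [set W | (detre W < s)%R] <=
   (\prod_(l < p) gamma_cdf1D s (q - l))%:E)%E.
Proof.
elim: p q => [|p IH] [|q] // pq.
- by rewrite big_ord0; apply: probability_le1; exact: measurable_detre_lt.
- by rewrite big_ord0; apply: probability_le1; exact: measurable_detre_lt.
set A := \prod_(l < p) gamma_cdf1D s (q - l).
have A0 : 0 <= A.
  by apply: prodr_ge0 => l _; rewrite gamma_cdf1D_ge0 // subn_gt0 (leq_trans (ltn_ord l)).
have := @integral_slice q p s A 0 s s A0 (lexx 0).
rewrite big_ord_recl subn0 mul0r addr0 mulrC; apply => a.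
have k1 : 1 <= 1 + c * nrm2 a by rewrite lerDl mulr_ge0 ?nrm2_ge0 ?ltW.
rewrite mul0r addr0 indicE; have [|] := boolP (a \in _).
  rewrite inE => ks; rewrite mulr1; apply: le_trans (IH q pq).
  apply: le_measure; rewrite ?inE; [exact: measurable_kdetre_lt|exact: measurable_detre_lt|].
  by move=> W /=; apply: le_lt_trans; exact: detre_le_kdetre.
rewrite notin_setE /= => /negP; rewrite -leNgt => sk.
by rewrite (kdetre_lt_eq0 q p (le_trans ler01 k1) sk) mulr0.
Qed.

(** The minimum makes the induction close: [prod u] equals [s] in the application, but the product
    over the remaining rows does not, while each factor must still stay below [s]. *)
Lemma bartlett_bound p q (s : R) (u : nat -> R) : (p <= q)%N ->
  (forall l, (l < p)%N -> 0 < u l <= s) ->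
  (plaw (ppow (ppow gaussC q) p)
     [set W | (detre W < Num.min s (\prod_(l < p) u l))%R] <=
   (\prod_(l < p) gamma_cdf1D s (q - l) -
    \prod_(l < p) (gamma_cdf1D s (q - l) - gamma_cdf1D (u l) (q - l)))%:E)%E.
Proof.
elim: p q u => [|p IH] q u pq us.
  rewrite !big_ord0 subrr (_ : [set W | _] = set0) ?measure0 // -subset0 => W /=.
  by rewrite lt_min => /andP[_]; rewrite ltNge detre_ge1.
case: q pq => // q pq.
set A := \prod_(l < p) gamma_cdf1D s (q - l).
set B := \prod_(l < p) (gamma_cdf1D s (q - l) - gamma_cdf1D (u l.+1) (q - l)).
have ql (l : 'I_p) : (0 < q - l)%N by rewrite subn_gt0 (leq_trans (ltn_ord l)).
have us' l : (l < p)%N -> 0 < u l.+1 <= s by move=> lp; exact: us.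
have B0 : 0 <= B.
  apply: prodr_ge0 => l _; rewrite subr_ge0 gamma_cdf1D_le //.
  by have /andP[] := us' l (ltn_ord l).
have BA : B <= A.
  apply: ler_prod => l _; rewrite subr_ge0 gamma_cdf1D_le //=; last first.
    by have /andP[] := us' l (ltn_ord l).
  by rewrite gerBl gamma_cdf1D_ge0.
have u0s : u 0%N <= s by have /andP[] := us 0%N isT.
have u0 : 0 < u 0%N by have /andP[] := us 0%N isT.
set x := Num.min _ _.
have AB0 : 0 <= A - B by rewrite subr_ge0.
have := @integral_slice q p x (A - B) B s (u 0%N) AB0 B0.
rewrite !big_ord_recl !subn0 -/A.
have -> : \prod_(i < p) (gamma_cdf1D s (q.+1 - lift ord0 i) -
    gamma_cdf1D (u (lift ord0 i)) (q.+1 - lift ord0 i)) = B.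
  by [].
(* A slice is bounded by [A] if [k < u 0], by [A - B] if [u 0 <= k < s], and by 0 if [s <= k]: this
   is [(A - B) 1_(k < s) + B 1_(k < u 0)]. *)
have -> : gamma_cdf1D s q.+1 * A - (gamma_cdf1D s q.+1 - gamma_cdf1D (u (@ord0 p)) q.+1) * B =
    (A - B) * gamma_cdf1D s q.+1 + B * gamma_cdf1D (u 0%N) q.+1 by rewrite /=; ring.
apply => a; set k := 1 + c * nrm2 a.
have k1 : 1 <= k by rewrite lerDl mulr_ge0 ?nrm2_ge0 ?ltW.
have k0 : 0 < k by rewrite (lt_le_trans ltr01).
rewrite !indicE; have [|] := boolP (a \in [set a | 1 + c * nrm2 a < u 0%N]).
  rewrite inE /= -/k => ku.
  have -> : a \in [set a | 1 + c * nrm2 a < s] by rewrite inE /= (lt_le_trans ku).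
  rewrite !mulr1 subrK; apply: le_trans (@bartlett_bound_top p q s pq).
  apply: le_measure; rewrite ?inE; [exact: measurable_kdetre_lt|exact: measurable_detre_lt|].
  move=> W /=; rewrite /x lt_min => /andP[+ _]; apply: le_lt_trans.
  exact: detre_le_kdetre.
rewrite notin_setE /= -/k => /negP; rewrite -leNgt => uk.
rewrite mulr0 addr0; have [|] := boolP (a \in _).
  rewrite inE /= => ks; rewrite mulr1.
  apply: le_trans (IH q (u \o S) pq us').
  apply: le_measure; rewrite ?inE; [exact: measurable_kdetre_lt|exact: measurable_detre_lt|].
  move=> W /=; rewrite /x !lt_min => /andP[h1 h2]; apply/andP; split.
    by apply: le_lt_trans h1; exact: detre_le_kdetre.
  (* From [k D < u_0 u_1 ...] and [u_0 <= k] follows [D < u_1 u_2 ...]. *)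
  rewrite -(ltr_pM2l k0); apply: (lt_le_trans h2).
  rewrite big_ord_recl /= ler_wpM2r //.
  by apply: prodr_ge0 => l _; have /andP[/ltW] := us' l (ltn_ord l).
rewrite notin_setE /= -/k => /negP; rewrite -leNgt => sk.
have xk : x <= k by rewrite (le_trans _ sk) // /x ge_min lexx.
by rewrite (kdetre_lt_eq0 q p (ltW k0) xk) mulr0.
Qed.

End bartlett.

(** * Transfer to the given probability space *)

Section packing.
Variable R : realType.
Local Notation gaussC := (gaussC R).

Fixpoint pack (X : pspace R) (f : nat -> X) (n : nat) : ppow X n :=
  if n is n'.+1 then (f 0%N, @pack X (f \o S) n') else tt.

Lemma in_boxset (X : pspace R) (f : nat -> X) (A : nat -> set X) n :
  boxset A n (pack f n) <-> forall i, (i < n)%N -> A i (f i).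
Proof.
elim: n f A => [|n IH] f A; first by split.
split=> [[/= h0 /IH h] [|i] //|h]; first exact: h.
by split => /=; [exact: h|apply/IH => i lin; exact: h].
Qed.

Lemma measurable_pack (X Y : pspace R) (f : nat -> X -> Y) n :
  (forall i, measurable_fun setT (f i)) ->
  measurable_fun setT (fun t => pack (f ^~ t) n).
Proof.
elim: n f => [|n IH] f mf; first exact: measurable_cst.
apply: measurable_pair; first exact: mf.
by apply: (IH (fun i => f i.+1)) => i; exact: mf.
Qed.

Lemma boxsetT (X : pspace R) n : boxset (fun=> [set: X]) n = setT.
Proof.
elim: n => //= n IH.
have -> : ((fun=> [set: X]) \o S) = (fun=> [set: X]) by [].
by rewrite IH setXTT.
Qed.

Lemma rowof_pack q (f : nat -> gaussC) : rowof (pack f q) = \row_j toC (f j).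
Proof.
elim: q f => [|q IH] f; first by rewrite [RHS]thinmx0.
apply/matrixP => i j; rewrite (ord1 i) /= IH !mxE.
case: (@fintype.splitP 1 q j) => k jk; rewrite !mxE jk.
  by rewrite (ord1 k) eqxx mulr1n.
by [].
Qed.

Lemma matof_pack q p (f : nat -> nat -> gaussC) :
  matof (pack (fun i => pack (f i) q) p) = \matrix_(i, j) toC (f i j).
Proof.
elim: p f => [|p IH] f; first by rewrite [RHS]flatmx0.
apply/matrixP => i j; rewrite /= (IH (fun i => f i.+1)) rowof_pack !mxE.
by case: (@fintype.splitP 1 p i) => k ik; rewrite !mxE ik ?(ord1 k).
Qed.

Section law.
Context (d : measure_display) (T : measurableType d) (P : probability T R).
Variables (p q : nat) (H : T -> 'M[R[i]]_(p.+1, q.+1)).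
Hypothesis iidH : iid_CN01 P H.

(** Indexed by naturals to suit [pack]; [inord] supplies some entry for indices out of range, hence
    the nonempty dimensions. *)
Definition entry (t : T) (i j : nat) : gaussC :=
  (complex.Re (H t (inord i) (inord j)), complex.Im (H t (inord i) (inord j))).

Definition mpack (t : T) : ppow (ppow gaussC q.+1) p.+1 :=
  pack (fun i => pack (entry t i) q.+1) p.+1.

Lemma matof_mpack t : matof (mpack t) = H t.
Proof.
rewrite /mpack matof_pack; apply/matrixP => i j; rewrite mxE /toC /entry /=.
by rewrite !inord_val; case: (H t i j).
Qed.

(** [iid_CN01] prescribes the probability of boxes whose side at each entry is a rectangle of the
    complex plane; such boxes determine a law on the nested product. *)
Lemma mpres_mpack : @mpres R (Pspace P) (ppow (ppow gaussC q.+1) p.+1) mpack.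
Proof.
have dm := @determining_measurable R.
have dC := determining_prod (dm (gaussR R)) (dm (gaussR R)).
set GC := (X in determining X) in dC.
have GCT : GC setT by exists setT, setT; split => //; rewrite setXTT.
have dV := determining_boxset q.+1 dC GCT.
set GV := (X in determining X) in dV.
have GVT : GV setT by exists (fun=> setT) => //; exact: boxsetT.
apply: (mpres_determining (determining_boxset p.+1 dV GVT)).
  apply: (@measurable_pack (Pspace P) (ppow gaussC q.+1) (fun i t => pack (entry t i) q.+1)) => i.
  apply: (@measurable_pack (Pspace P) gaussC (fun j t => entry t i j)) => j.
  by have [m1 m2] := iidH.1 (inord i) (inord j); exact: measurable_fun_pair.
move=> _ [A GA <-].
(* A box is given row by row and entry by entry; choice collects its real and imaginary sides into
   two families, as [iid_CN01] expects. *)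
have /choice[A1 hA1] : forall i : nat, exists B : nat -> set gaussC,
    (forall j, GC (B j)) /\ @boxset R gaussC B q.+1 = A i.
  by move=> i; have [B hB1 hB2] := GA i; exists B.
have /choice[A2 hA2] : forall i : nat,
    exists B : nat -> set (gaussR R) * set (gaussR R), forall j : nat,
    measurable (B j).1 /\ measurable (B j).2 /\ A1 i j = (B j).1 `*` (B j).2.
  move=> i; have := (hA1 i).1; move: (A1 i) => A1i hi.
  have /choice[B hB] : forall j : nat, exists B : set (gaussR R) * set (gaussR R),
      measurable B.1 /\ measurable B.2 /\ A1i j = B.1 `*` B.2.
    by move=> j; have [B [D [mB mD E]]] := hi j; exists (B, D).
  by exists B.
have mA1 i j : measurable (A1 i j) by apply: dC.1; exact: (hA1 i).1.
have mA i : measurable (A i) by apply: dV.1.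
rewrite plaw_boxset //.
have := iidH.2 (fun i j => (A2 i j).1) (fun i j => (A2 i j).2).
move=> /(_ (fun i j => conj (hA2 i j).1 (hA2 i j).2.1)) h.
transitivity (P [set t | forall (i : 'I_p.+1) (j : 'I_q.+1),
  (A2 i j).1 (complex.Re (H t i j)) /\ (A2 i j).2 (complex.Im (H t i j))]).
  congr (P _); apply/seteqP; split => t.
    move=> /(in_boxset (fun i => pack (entry t i) q.+1) A p.+1).1 hb i j.
    have := hb i (ltn_ord i).
    rewrite -(hA1 i).2 => /(in_boxset (entry t i) (A1 i) q.+1).1 /(_ j (ltn_ord j)).
    by rewrite (hA2 i j).2.2 /entry !inord_val.
  move=> hb; apply: (in_boxset (fun i => pack (entry t i) q.+1) A p.+1).2 => i ip.
  rewrite -(hA1 i).2; apply: (in_boxset (entry t i) (A1 i) q.+1).2 => j jq.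
  rewrite (hA2 i j).2.2; have := hb (Ordinal ip) (Ordinal jq).
  have iE : inord i = Ordinal ip by apply/val_inj; exact: inordK.
  have jE : inord j = Ordinal jq by apply/val_inj; exact: inordK.
  by rewrite /entry iE jE.
rewrite h; congr EFin; apply: eq_bigr => i _.
rewrite -(hA1 i).2 plaw_boxset //; apply: eq_bigr => j _.
rewrite (hA2 i j).2.2 (@plaw_prodE R (gaussR R) (gaussR R)).
- by rewrite fineM ?fin_num_measure //; [exact: (hA2 i j).1|exact: (hA2 i j).2.1].
- exact: (hA2 i j).1.
- exact: (hA2 i j).2.1.
Qed.

Lemma outage_law (c x : R) :
  P [set t | complex.Re (detI c%:C%C (H t)) < x] =
  plaw (ppow (ppow gaussC q.+1) p.+1) [set W | detre c W < x].
Proof.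
rewrite -(mpres_mpack.2 _ (measurable_detre_lt c q.+1 p.+1 x)).
by congr (P _); apply/seteqP; split => t /=; rewrite /detre matof_mpack.
Qed.

End law.

Lemma iid_CN01_tr (d : measure_display) (T : measurableType d)
    (P : probability T R) p q (H : T -> 'M[R[i]]_(p, q)) :
  iid_CN01 P H -> iid_CN01 P (fun t => (H t)^T).
Proof.
move=> [mH hH]; split.
  move=> i j; have [m1 m2] := mH j i; split; under eq_fun do rewrite mxE; exact.
move=> A B mAB.
have := hH (fun i j => A j i) (fun i j => B j i) (fun i j => mAB j i).
rewrite exchange_big /= => <-; congr (P _).
by apply/seteqP; split => t /= h i j; have := h j i; rewrite mxE.
Qed.

Lemma prod_sub_factor m (X Y : nat -> R) :
  (forall l, (l < m)%N -> 0 <= Y l <= X l) ->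
  \prod_(l < m) X l - \prod_(l < m) (X l - Y l) =
  \prod_(l < m) X l * (1 - \prod_(l < m) (1 - Y l / X l)).
Proof.
move=> XY; rewrite mulrBr mulr1 -big_split; congr (_ - _).
apply: eq_bigr => l _; rewrite /= mulrBr mulr1.
have /andP[Y0 YX] := XY l (ltn_ord l).
(* When [X l = 0] also [Y l = 0], so the value of the quotient does not matter. *)
have [X0|X0] := eqVneq (X l) 0; last by rewrite mulrCA divff // mulr1.
have -> : Y l = 0 by apply/eqP; rewrite eq_le Y0 andbT -X0.
by rewrite mul0r mulr0.
Qed.

Lemma outage_bound (d : measure_display) (T : measurableType d)
    (P : probability T R) p q (H : T -> 'M[R[i]]_(p, q))
    (n : nat) (eta g rs : R) (b : nat -> R) :
  (0 < n)%N -> (0 < p <= q)%N -> iid_CN01 P H -> 0 < eta -> 0 < g -> 0 < rs ->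
  (forall l, (1 <= l <= p)%N -> 0 < b l) ->
  \sum_(1 <= l < p.+1) b l = rs ->
  (P [set t | (ln (complex.Re (detI (eta / n%:R)%:C%C (H t))) <
               rs * ln (1 + g * eta))%R] <=
   ((\prod_(1 <= l < p.+1) Gamma_inc (xi n eta g rs) (q - l + 1)) *
    (1 - \prod_(1 <= l < p.+1) (1 - Gamma_inc (xi n eta g (b l)) (q - l + 1) /
                                    Gamma_inc (xi n eta g rs) (q - l + 1))))%:E)%E.
Proof.
move=> n0 /andP[p0 pq] iidH eta0 g0 rs0 b0 sb.
set c := eta / n%:R; have c0 : 0 < c by rewrite divr_gt0 // ltr0n.
set x := 1 + g * eta; have x1 : 1 < x by rewrite ltrDl mulr_gt0.
have x0 : 0 < x by rewrite (lt_trans ltr01).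
pose s := x `^ rs; pose u l := x `^ b l.+1.
have s0 : 0 < s by rewrite powR_gt0.
(* The index starts at 1 in the theorem and at 0 here; [l < q] keeps the truncated subtraction
   exact. *)
have GE y l : (l < p)%N -> Gamma_inc (xi n eta g y) (q - l.+1 + 1) = gamma_cdf1D c (x `^ y) (q - l).
  move=> lp; have lq := leq_trans lp pq.
  rewrite addn1 -subSn // subSS /gamma_cdf1D /xi -/x mulrC /c invf_div //.
rewrite !big_add1 !big_mkord.
under eq_bigr => l _ do rewrite GE //.
under [X in 1 - X]eq_bigr => l _ do rewrite !GE //.
have ql l : (l < p)%N -> (0 < q - l)%N by move=> lp; rewrite subn_gt0 (leq_trans lp).
have bE : \sum_(l < p) b l.+1 = rs by rewrite -sb big_add1 big_mkord.
have b0' (l : 'I_p) : 0 < b l.+1 by apply: b0; rewrite /= ltn_ord.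
(* Each coefficient is at most [rs], the others being positive. *)
have us l : (l < p)%N -> 0 < u l <= s.
  move=> lp; rewrite powR_gt0 //=; apply: ler_powR; first exact: ltW.
  rewrite -bE (bigD1 (Ordinal lp)) //= lerDl sumr_ge0 // => i _; exact: ltW.
have su : \prod_(l < p) u l = s.
  rewrite /s -bE; elim: (index_enum _) => [|i r IH].
    by rewrite !big_nil powRr0.
  by rewrite !big_cons IH powRD //; apply/implyP => _; rewrite gt_eqF.
rewrite -(@prod_sub_factor p (fun l => gamma_cdf1D c s (q - l))
  (fun l => gamma_cdf1D c (u l) (q - l))); last first.
  move=> l lp; rewrite gamma_cdf1D_ge0 ?ql //= gamma_cdf1D_le ?ql //.
  by have /andP[] := us l lp.
apply: le_trans (bartlett_bound c0 pq us).
rewrite su minxx.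
case: p q H iidH pq p0 {GE ql b0 sb b0' us bE su} => // p [|q] // H iidH pq _.
rewrite -(outage_law iidH) le_eqVlt; apply/orP; left; apply/eqP; congr (P _).
apply/funext => t /=; congr is_true.
(* A determinant of at least 1 is in the domain of [ln], so the logarithmic event is exactly
   [D < s]. *)
have : 1 <= detI c%:C%C (H t) by apply: detI_ge1; rewrite ler0c ltW.
rewrite lecE => /andP[_] /=; set D := complex.Re _ => D1.
have D0 : 0 < D by rewrite (lt_le_trans ltr01).
by rewrite /s /powR gt_eqF // -[in RHS](lnK (x := D)) ?posrE // ltr_expR.
Qed.

End packing.

Theorem theorem1 (R : realType) (d : measure_display) (T : measurableType d)
  (P : probability T R) (Nt Nm Ne : nat) (H : T -> 'M[R[i]]_(Nm, Nt - Ne))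
  (eta g rs : R) (b : nat -> R) :
  (0 < Nt)%N -> (0 < Nm)%N -> (0 < Ne)%N -> (Ne < Nt)%N ->
  iid_CN01 P H ->
  0 < eta -> 0 < g -> 0 < rs ->
  (forall l, (1 <= l <= minn (Nt - Ne) Nm)%N -> 0 < b l) ->
  (forall l, (1 <= l < minn (Nt - Ne) Nm)%N -> b l.+1 <= b l) ->
  \sum_(1 <= l < (minn (Nt - Ne) Nm).+1) b l = rs ->
  (outage_ZF P H eta g rs <=
   ((\prod_(1 <= l < (minn (Nt - Ne) Nm).+1)
        Gamma_inc (xi (Nt - Ne) eta g rs) (maxn (Nt - Ne) Nm - l + 1))
    * (1 - \prod_(1 <= l < (minn (Nt - Ne) Nm).+1)
             (1 - Gamma_inc (xi (Nt - Ne) eta g (b l)) (maxn (Nt - Ne) Nm - l + 1)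
                  / Gamma_inc (xi (Nt - Ne) eta g rs) (maxn (Nt - Ne) Nm - l + 1))))%:E)%E.
Proof.
move=> _ Nm0 _; rewrite -subn_gt0; move: (Nt - Ne)%N H => n H n0 iidH eta0 g0 rs0 b0 _ sb.
have [le_mn|/ltnW le_nm] := leqP Nm n.
  rewrite (minn_idPr le_mn) in b0 sb.
  by apply: outage_bound => //; rewrite Nm0.
(* [H] has more rows than columns here, so the bound is applied to its transpose, which has the same
   determinant. *)
rewrite (minn_idPl le_nm) in b0 sb.
apply: le_trans (outage_bound n0 _ (iid_CN01_tr iidH) eta0 g0 rs0 b0 sb); last by rewrite n0.
rewrite /outage_ZF le_eqVlt; apply/orP; left; apply/eqP; congr (P _).
by apply/funext => t /=; rewrite -detI_tr.
Qed.
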